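(* In the two-firm negotiation game described in the context, suppose $\beta_1\le\beta_2$. Then the alternating iterative procedure $S_0:=\emptyset$, $T_n:=\Gamma_2(S_n)$, $S_{n+1}:=\Gamma_1(T_n)$ ($n=0,1,2,\dots$) terminates after one iteration (i.e. $S_n=S_0$ and $T_n=T_0$ for all $n$) and gives a sharp inter-personal equilibrium. That is, with $S_\infty:=\bigcup_nS_n$ and $T_\infty:=\bigcap_nT_n$, $$(S_\infty,T_\infty)=(S_0,T_0)=(\emptyset,(0,y_2^*]\cap\mathbb{X})\in\widehat{\mathcal{E}}.$$
   Context: Two-firm negotiation game. $\mathbb{Z}_+=\{0,1,2,\dots\}$, $\mathbb{N}=\{1,2,\dots\}$. Fix $u>1$ and $p\in(0,1)$ with $p\ge\frac1{u+1}$. $X=(X_t)_{t\in\mathbb{Z}_+}$ is the time-homogeneous Markov chain on $\mathbb{X}=\{u^j:j=0,\pm1,\pm2,\dots\}$ with $\mathbb{P}_x(X_1/x=u)=p$ and $\mathbb{P}_x(X_1/x=1/u)=1-p$ for all $x\in\mathbb{X}$ (so $X$ is a submartingale); $\mathbb{P}_x$ is the law of $X$ started at $x$, $\mathbb{E}_x$ its expectation, $\mathcal{B}=2^{\mathbb{X}}$, and $\mathcal{T}$ is the set of stopping times of the filtration generated by $X$ (allowed to take the value $+\infty$). Fix $R>0$, $N\in(R/2,R)$ and $K:=R-N\in(0,R/2)$. For $i\in\{1,2\}$ and $x\in\mathbb{X}$, $f_i(x)=(K-x)^+$, $g_i(x)=N$, and $h_i:\mathbb{X}\to\mathbb{R}_+$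 is any function with $f_i\le h_i\le g_i$; the discount functions are $\delta_i(t)=\frac1{1+\beta_it}$ with constants $\beta_i>0$. For $\tau,\sigma\in\mathcal{T}$, $F_i(\tau,\sigma):=\delta_i(\tau)f_i(X_\tau)1_{\{\tau<\sigma\}}+\delta_i(\sigma)g_i(X_\sigma)1_{\{\tau>\sigma\}}+\delta_i(\tau)h_i(X_\tau)1_{\{\tau=\sigma\}}$, with $F_i(\tau,\sigma):=\limsup_{t\to\infty}\delta_i(t)h_i(X_t)$ on $\{\tau=\sigma=+\infty\}$, and $J_i(x,\tau,\sigma):=\mathbb{E}_x[F_i(\tau,\sigma)]$ ($\tau$ is Player/Firm $i$'s stopping time, $\sigma$ the other's). For $S\in\mathcal{B}$, $\rho_S:=\inf\{t\ge0:X_t\in S\}$ and $\rho_S^+:=\inf\{t>0:X_t\in S\}$ ($\inf\emptyset=\infty$). Equilibria. For $S,T\in\mathcal{B}$ let $\Theta_i^T(S):=\{x\in S: J_i(x,0,\rho_T)\ge J_i(x,\rho_S^+,\rho_T)\}\cup\{x\notin S: J_i(x,0,\rho_T)>J_i(x,\rho_S^+,\rho_T)\}$ and $\mathcal{E}_i^T:=\{S\in\mathcal{B}:\Theta_i^T(S)=S\}$ (intra-personal equilibria of Player $i$ with respect to $T$). For $S\in\mathcal{E}_i^T$ let $U_i^T(x,S):=\max\{J_i(x,0,\rho_T),J_i(x,\rho_S^+,\rho_T)\}$; $\widehat{\mathcal{E}}_i^T$ is the set of $S\in\mathcal{E}_i^T$ with $U_i^T(x,S)\ge U_i^T(x,R')$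 for all $R'\in\mathcal{E}_i^T$, $x\in\mathbb{X}$. A pair $(S,T)$ is a sharp inter-personal equilibrium if $S\in\widehat{\mathcal{E}}_1^T$ and $T\in\widehat{\mathcal{E}}_2^S$; $\widehat{\mathcal{E}}$ is the set of these. The maps $\Gamma_i$. Let $V_i^T(x,S):=\sup\{\mathbb{E}_x[F_i(\tau,\rho_T)]:\tau\in\mathcal{T},\,1\le\tau\le\rho_S^+\}$ and $\Phi_i^T(S):=S\cup\{x\notin S:J_i(x,0,\rho_T)>V_i^T(x,S)\}$. Put $S_i^1(T):=\Phi_i^T(\emptyset)$, $S_i^n(T):=\Phi_i^T(S_i^{n-1}(T))$ for $n\ge2$, and $\Gamma_i(T):=\bigcup_{n\in\mathbb{N}}S_i^n(T)$. Threshold. Let $Y$ be a random walk on the integers with $P(Y_{t+1}-Y_t=1)=p$, $P(Y_{t+1}-Y_t=-1)=1-p$, let $\xi:=\inf\{t\ge0:Y_t=0\}$, and $\alpha_i^1:=E\big[\frac1{1+\beta_i\xi}\,\big|\,Y_0=1\big]$ (the integrand being $0$ when $\xi=\infty$). Then $y_i^*:=\min\big\{\big[\frac{1-\alpha_i^1}{u-\alpha_i^1}K,\infty\big)\cap\mathbb{X}\big\}$. *)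

(* Defs.v *)
From HB Require Import structures.
From mathcomp Require Import all_boot all_order all_algebra.
From mathcomp Require Import all_classical all_reals all_analysis.

Set Implicit Arguments.
Unset Strict Implicit.
Unset Printing Implicit Defensive.

Import Order.TTheory GRing.Theory Num.Theory.
Import numFieldNormedType.Exports.

Local Open Scope classical_set_scope.
Local Open Scope ring_scope.

(* Random times take values in nat + {+oo}; [None] stands for +oo. *)
Definition xtime := option nat.

Definition xtime_le (s t : xtime) : bool :=
  match s, t with
  | _, None => true
  | None, Some _ => false
  | Some m, Some n => (m <= n)%N
  end.

Definition xtime_inf (A : set nat) : xtime :=
  if pselect (exists n, `[< A n >]) is left exA then Some (ex_minn exA)
  else None.

Section Processes.
Context {d : measure_display} {Omega : measurableType d} {R : realType}.

(* Discrete-time Markov chain with values in the countable set [St] and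
   one-step transition probabilities [q], started at [x] under [P x]. *)
Definition markov_chain (St : set R) (q : R -> R -> R)
    (P : R -> probability Omega R) (X : nat -> Omega -> R) : Prop :=
  [/\ forall t, measurable_fun [set: Omega] (X t),
      forall t w, St (X t w),
      forall x, St x -> P x [set w | X 0%N w = x] = 1%E &
      forall x, St x -> forall (n : nat) (s : nat -> R),
        P x [set w | forall k, (k <= n.+1)%N -> X k w = s k] =
        (P x [set w | forall k, (k <= n)%N -> X k w = s k]
           * (q (s n) (s n.+1))%:E)%E].

Definition walk_step (p : R) (e : int) : R :=
  if e == 1 then p else if e == -1 then 1 - p else 0.

(* The increments of [Y] are i.i.d. with law [walk_step p] and independent of
   [Y 0], whose law is arbitrary. *)
Definition random_walk (p : R) (Q : probability Omega R)
    (Y : nat -> Omega -> int) : Prop :=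
  (forall t y, measurable [set w | Y t w = y]) /\
  (forall (n : nat) (y : int) (e : nat -> int),
     Q [set w | Y 0%N w = y /\
                forall k, (k < n)%N -> Y k.+1 w - Y k w = e k] =
     (Q [set w | Y 0%N w = y] * (\prod_(k < n) walk_step p (e k))%:E)%E).

Definition cond_expectation (Q : probability Omega R) (A : set Omega)
    (Z : Omega -> R) : R :=
  (\int[Q]_(w in A) Z w) / fine (Q A).

Definition walk_hit0 (Y : nat -> Omega -> int) (w : Omega) : xtime :=
  xtime_inf [set t | Y t w = 0].

Definition alpha1 (beta : R) (Q : probability Omega R)
    (Y : nat -> Omega -> int) : R :=
  cond_expectation Q [set w | Y 0%N w = 1]
    (fun w => if walk_hit0 Y w is Some t then (1 + beta * t%:R)^-1 else 0).

Definition history (X : nat -> Omega -> R) (n : nat) : set (set Omega) :=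
  <<s [set A | exists k, (k <= n)%N /\ exists B : set R, A = X k @^-1` B] >>.

Definition stopping_time (X : nat -> Omega -> R) (tau : Omega -> xtime) : Prop :=
  forall n, history X n [set w | xtime_le (tau w) (Some n)].

(* [hit X S] and [hit_pos X S] are rho_S and rho_S^+. *)
Definition hit (X : nat -> Omega -> R) (S : set R) (w : Omega) : xtime :=
  xtime_inf [set t | S (X t w)].

Definition hit_pos (X : nat -> Omega -> R) (S : set R) (w : Omega) : xtime :=
  xtime_inf [set t | (0 < t)%N /\ S (X t w)].

End Processes.

Record player (R : realType) := Player {
  disc : nat -> R;
  fpay : R -> R;
  gpay : R -> R;
  hpay : R -> R
}.

Section DynkinGame.
Context {d : measure_display} {Omega : measurableType d} {R : realType}.
Variables (St : set R) (P : R -> probability Omega R) (X : nat -> Omega -> R).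

Definition payoff (a : player R) (tau sigma : Omega -> xtime) (w : Omega) : R :=
  match tau w, sigma w with
  | Some t, Some s =>
      if (t < s)%N then disc a t * fpay a (X t w)
      else if (s < t)%N then disc a s * gpay a (X s w)
      else disc a t * hpay a (X t w)
  | Some t, None => disc a t * fpay a (X t w)
  | None, Some s => disc a s * gpay a (X s w)
  | None, None => limn_sup (fun t => disc a t * hpay a (X t w))
  end.

Definition J (a : player R) (x : R) (tau sigma : Omega -> xtime) : \bar R :=
  'E_(P x)[payoff a tau sigma].

Definition time0 : Omega -> xtime := fun=> Some 0%N.

Definition J_stop (a : player R) (T : set R) (x : R) : \bar R :=
  J a x time0 (hit X T).

Definition J_cont (a : player R) (T S : set R) (x : R) : \bar R :=
  J a x (hit_pos X S) (hit X T).

Definition Theta (a : player R) (T S : set R) : set R :=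
  [set x | S x /\ (J_stop a T x >= J_cont a T S x)%E] `|`
  [set x | (St x /\ ~ S x) /\ (J_stop a T x > J_cont a T S x)%E].

Definition intra_eq (a : player R) (T : set R) : set (set R) :=
  [set S | S `<=` St /\ Theta a T S = S].

Definition U (a : player R) (T : set R) (x : R) (S : set R) : \bar R :=
  maxe (J_stop a T x) (J_cont a T S x).

Definition optimal_intra_eq (a : player R) (T : set R) : set (set R) :=
  [set S | intra_eq a T S /\
     forall S', intra_eq a T S' ->
     forall x, St x -> (U a T x S >= U a T x S')%E].

Definition sharp_inter_eq (a1 a2 : player R) : set (set R * set R) :=
  [set ST | [/\ ST.1 `<=` St, ST.2 `<=` St,
                optimal_intra_eq a1 ST.2 ST.1 &
                optimal_intra_eq a2 ST.1 ST.2]].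

Definition V (a : player R) (T : set R) (x : R) (S : set R) : \bar R :=
  ereal_sup [set v | exists tau : Omega -> xtime,
    [/\ stopping_time X tau,
        forall w, xtime_le (Some 1%N) (tau w),
        forall w, xtime_le (tau w) (hit_pos X S w) &
        v = J a x tau (hit X T)]].

Definition Phi (a : player R) (T S : set R) : set R :=
  S `|` [set x | (St x /\ ~ S x) /\ (J_stop a T x > V a T x S)%E].

(* [iter n (Phi a T) set0] is S^n(T) for n >= 1. *)
Definition Gamma (a : player R) (T : set R) : set R :=
  \bigcup_(n in [set n | (1 <= n)%N]) iter n (Phi a T) set0.

Fixpoint alt_S (a1 a2 : player R) (n : nat) : set R :=
  if n is m.+1 then Gamma a1 (Gamma a2 (alt_S a1 a2 m)) else set0.

Definition alt_T (a1 a2 : player R) (n : nat) : set R :=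
  Gamma a2 (alt_S a1 a2 n).

End DynkinGame.

Section Negotiation.
Context {R : realType}.

Definition states (u : R) : set R := range (fun j : int => u ^ j).

Definition transition (u p x y : R) : R :=
  if y / x == u then p else if y / x == u^-1 then 1 - p else 0.

Definition firm (K N beta : R) (h : R -> R) : player R :=
  {| disc := fun t => (1 + beta * t%:R)^-1;
     fpay := fun x => Num.max (K - x) 0;
     gpay := fun=> N;
     hpay := h |}.

(* Defaults to 0 when [A] has no least element. *)
Definition set_min (A : set R) : R :=
  xget 0 [set y | A y /\ forall z, A z -> y <= z].

Definition threshold (u K alpha : R) : R :=
  set_min [set y | (1 - alpha) / (u - alpha) * K <= y /\ states u y].

End Negotiation.

(* Main.v *)
(* Write [a_k] for the expected discount factor at the first time a walk started
   [k] steps above a level [y] reaches [y]. Since [d s * d t <= d (s + t)] for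
   the hyperbolic discount [d], [a_1 * a_k <= a_k.+1], so if
   [K - u y <= a_1 (K - y)] then from every state above [y] waiting for [y] is at
   least as good as stopping; this holds exactly from [y = y*] upwards.
   With firm 1 never stopping, firm 2 therefore waits above [y*]. At [u y] with
   [y < y*] stopping at once strictly beats every stopping time that is at least
   1 and at most the hitting time of [y], by a space-time supermartingale bound
   that uses the submartingale property of the chain; hence the iteration fills
   [(0, y*]] upwards from the small states. Against this region firm 1, being
   more patient and receiving [N > K] when firm 2 stops, prefers never to stop.
   The expectations are bounded by backward induction on the finite-horizon
   binary tree of paths, followed by monotone convergence. *)

Require Import Defs.
From HB Require Import structures.
From mathcomp Require Import all_boot all_order all_algebra.
From mathcomp Require Import all_classical all_reals all_analysis.
From mathcomp Require Import measurable_realfun ring lra zify.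

Set Implicit Arguments.
Unset Strict Implicit.
Unset Printing Implicit Defensive.

Import Order.TTheory GRing.Theory Num.Theory.
Import numFieldNormedType.Exports.

Local Open Scope classical_set_scope.
Local Open Scope ring_scope.

(** * Discounted hitting times of a nearest-neighbour walk *)

Section DiscountedHitting.
Context {R : realType}.
Implicit Types (beta p : R) (n t s j k : nat).

Definition hdisc beta t : R := (1 + beta * t%:R)^-1.

Lemma hdisc0 beta : hdisc beta 0 = 1.
Proof. by rewrite /hdisc mulr0 addr0 invr1. Qed.

Lemma hdisc_den_gt0 beta t : 0 < beta -> 0 < 1 + beta * t%:R.
Proof. by move=> b0; rewrite ltr_pwDl // mulr_ge0 // ltW. Qed.

Lemma hdisc_gt0 beta t : 0 < beta -> 0 < hdisc beta t.
Proof. by move=> b0; rewrite invr_gt0 hdisc_den_gt0. Qed.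

Lemma hdisc_le beta s t : 0 < beta -> (s <= t)%N -> hdisc beta t <= hdisc beta s.
Proof.
move=> b0 st; rewrite /hdisc lef_pV2 ?posrE ?hdisc_den_gt0 //.
by rewrite lerD2l ler_pM2l // ler_nat.
Qed.

Lemma hdisc1_lt1 beta : 0 < beta -> hdisc beta 1 < 1.
Proof. by move=> b0; rewrite /hdisc mulr1 invf_lt1 ?ltrDl ?addr_gt0. Qed.

(** The product of the denominators exceeds the denominator at [s + t] by the cross term
    [beta^2 s t]. This decreasing impatience is what drives [hitdD]. *)
Lemma hdiscM beta s t : 0 < beta ->
  hdisc beta s * hdisc beta t <= hdisc beta (s + t).
Proof.
move=> b0; rewrite /hdisc -invfM lef_pV2 ?posrE ?mulr_gt0 ?hdisc_den_gt0 //.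
rewrite natrD; have : 0 <= beta * s%:R * (beta * t%:R).
  by rewrite !mulr_ge0 // ltW.
by set a := s%:R; set b := t%:R => h; lra.
Qed.

Lemma hdisc_anti beta beta' t : 0 < beta -> beta <= beta' ->
  hdisc beta' t <= hdisc beta t.
Proof.
move=> b0 bb; have b0' := lt_le_trans b0 bb.
by rewrite /hdisc lef_pV2 ?posrE ?hdisc_den_gt0 // lerD2l ler_wpM2r.
Qed.

(* [hitn beta p n t k] is the expectation of [hdisc beta (t + xi)] on
   [xi < n], where [xi] is the first time a walk started at [k] hits 0. *)
Fixpoint hitn beta p n t k : R :=
  if n is m.+1 then
    if k is j.+1 then p * hitn beta p m t.+1 j.+2 + (1 - p) * hitn beta p m t.+1 j
    else hdisc beta t
  else 0.

(** This is the expectation of [hdisc beta (t + xi)], counted as 0 when [xi] is infinite. For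
    [beta > 0] the limit exists, as [hitn] is nondecreasing and bounded in [n]. *)
Definition hitd beta p t k : R := limn (fun n => hitn beta p n t k).

Variable (p : R).
Hypothesis (p0 : 0 < p) (p1 : p < 1).

Let q0 : 0 < 1 - p. Proof. by rewrite subr_gt0. Qed.

Lemma hitn_ge0 beta n t k : 0 < beta -> 0 <= hitn beta p n t k.
Proof.
move=> b0; elim: n t k => [//|n IH] t [|k] /=; first exact/ltW/hdisc_gt0.
by rewrite addr_ge0 // mulr_ge0 // ltW.
Qed.

Lemma hitn_le_hdisc beta n t k : 0 < beta -> hitn beta p n t k <= hdisc beta t.
Proof.
move=> b0; elim: n t k => [|n IH] t [|k] //=; try exact/ltW/hdisc_gt0.
have h1 := IH t.+1 k.+2; have h2 := IH t.+1 k.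
have h3 := hdisc_le b0 (leqnSn t).
have : p * hitn beta p n t.+1 k.+2 <= p * hdisc beta t.
  by rewrite ler_pM2l // (le_trans h1).
have : (1 - p) * hitn beta p n t.+1 k <= (1 - p) * hdisc beta t.
  by rewrite ler_pM2l // (le_trans h2).
lra.
Qed.

Lemma hitn_leS beta n t k : 0 < beta ->
  hitn beta p n t k <= hitn beta p n.+1 t k.
Proof.
move=> b0; elim: n t k => [|n IH] t k; first by rewrite hitn_ge0.
by case: k => [//|k]; rewrite /= lerD // ler_pM2l //; exact: IH.
Qed.

Lemma hitn_shift beta n t s k : 0 < beta ->
  hdisc beta t * hitn beta p n s k <= hitn beta p n (t + s) k.
Proof.
move=> b0; elim: n s k => [|n IH] s [|k] /=; rewrite ?mulr0 //.
  exact: hdiscM.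
rewrite mulrDr !(mulrCA (hdisc beta t)) -addnS.
by rewrite lerD // ler_pM2l.
Qed.

Lemma hitn_anti_t beta n t k : 0 < beta ->
  hitn beta p n t.+1 k <= hitn beta p n t k.
Proof.
move=> b0; elim: n t k => [|n IH] t [|k] //=; first exact: hdisc_le.
by rewrite lerD // ler_pM2l.
Qed.

Lemma hitn_anti_beta beta beta' n t k : 0 < beta -> beta <= beta' ->
  hitn beta' p n t k <= hitn beta p n t k.
Proof.
move=> b0 bb; elim: n t k => [|n IH] t [|k] //=; first exact: hdisc_anti.
by rewrite lerD // ler_pM2l.
Qed.

Lemma is_cvg_hitn beta t k : 0 < beta -> cvgn (fun n => hitn beta p n t k).
Proof.
move=> b0; apply: nondecreasing_is_cvgn.
  by apply/nondecreasing_seqP => n; exact: hitn_leS.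
by exists (hdisc beta t) => _ [n _ <-]; exact: hitn_le_hdisc.
Qed.

Lemma hitd_ub beta t k c : 0 < beta ->
  (forall n, hitn beta p n t k <= c) -> hitd beta p t k <= c.
Proof.
move=> b0 h; apply: limr_le; first exact: is_cvg_hitn.
exact: nearW.
Qed.

Lemma hitn_le_hitd beta n t k : 0 < beta -> hitn beta p n t k <= hitd beta p t k.
Proof.
move=> b0; apply: (nondecreasing_cvgn_le (u_ := fun n => hitn beta p n t k)).
  by apply/nondecreasing_seqP => m; exact: hitn_leS.
exact: is_cvg_hitn.
Qed.

Lemma hitd0 beta t : 0 < beta -> hitd beta p t 0 = hdisc beta t.
Proof.
move=> b0; apply/eqP; rewrite eq_le hitd_ub //=; last first.
  by move=> n; exact: hitn_le_hdisc.
exact: (hitn_le_hitd 1 t 0 b0).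
Qed.

Lemma hitdS beta t k : 0 < beta -> hitd beta p t k.+1 =
  p * hitd beta p t.+1 k.+2 + (1 - p) * hitd beta p t.+1 k.
Proof.
move=> b0; apply/cvg_lim; first exact: Rhausdorff.
rewrite -cvg_shiftS /=.
by apply: cvgD; apply: cvgMr; exact: is_cvg_hitn.
Qed.

Lemma hitd_ge0 beta t k : 0 < beta -> 0 <= hitd beta p t k.
Proof. by move=> b0; exact: (hitn_le_hitd 0 t k b0). Qed.

Lemma hitd_le_hdisc beta t k : 0 < beta -> hitd beta p t k <= hdisc beta t.
Proof. by move=> b0; apply: hitd_ub => // n; exact: hitn_le_hdisc. Qed.

Lemma hitd_shift beta t k : 0 < beta ->
  hdisc beta t * hitd beta p 0 k <= hitd beta p t k.
Proof.
move=> b0; have d0 := hdisc_gt0 t b0.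
rewrite mulrC -ler_pdivlMr //; apply: hitd_ub => // n.
rewrite ler_pdivlMr // mulrC (le_trans (hitn_shift _ _ _ _ b0)) //.
by rewrite addn0 hitn_le_hitd.
Qed.

Lemma hitd_anti_beta beta beta' t k : 0 < beta -> beta <= beta' ->
  hitd beta' p t k <= hitd beta p t k.
Proof.
move=> b0 bb; apply: hitd_ub => [|n]; first exact: lt_le_trans bb.
exact: le_trans (hitn_anti_beta _ _ _ b0 bb) (hitn_le_hitd _ _ _ b0).
Qed.

(* Strong Markov at the first visit to [k], combined with
   [hdisc s * hdisc t <= hdisc (s + t)]. *)
Lemma hitdD beta t j k : 0 < beta ->
  hitd beta p t j * hitd beta p 0 k <= hitd beta p t (j + k).
Proof.
move=> b0; have := hitd_ge0 0 k b0; rewrite le_eqVlt => /predU1P[<-|k0].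
  by rewrite mulr0 hitd_ge0.
(* Dividing by the positive second factor allows the first one alone to be replaced by its
   finite-horizon version, on which the induction runs. *)
rewrite -ler_pdivlMr //; apply: hitd_ub => // n; rewrite ler_pdivlMr //.
elim: n t j => [|n IH] t [|j] /=; rewrite ?mul0r ?hitd_ge0 ?add0n //.
  exact: hitd_shift.
by rewrite addSn hitdS // mulrDl -!mulrA lerD // ler_pM2l //; exact: IH.
Qed.

(** In [hitdS] the clock advances by one; resetting it to 0 can only raise the discount factor. *)
Lemma hitd_sub beta k : 0 < beta ->
  hitd beta p 0 k.+1 <= p * hitd beta p 0 k.+2 + (1 - p) * hitd beta p 0 k.
Proof.
move=> b0; rewrite hitdS // lerD // ler_pM2l //; apply: hitd_ub => // n;
  exact: le_trans (hitn_anti_t _ _ _ b0) (hitn_le_hitd _ _ _ b0).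
Qed.

Lemma hitd1_lt1 beta : 0 < beta -> hitd beta p 0 1 < 1.
Proof.
move=> b0; rewrite hitdS // hitd0 //.
have h1 := hitd_le_hdisc 1 2 b0; have h2 := hdisc1_lt1 b0.
have : p * hitd beta p 1 2 <= p * hdisc beta 1 by rewrite ler_pM2l.
by move: h2; lra.
Qed.

Lemma hitd1_gt0 beta : 0 < beta -> 0 < hitd beta p 0 1.
Proof.
move=> b0; rewrite hitdS // hitd0 // ltr_wpDl //.
  by rewrite mulr_ge0 ?hitd_ge0 // ltW.
by rewrite mulr_gt0 // hdisc_gt0.
Qed.

(** With [a = hitd beta p 0 1] the last hypothesis reads [K - u y <= a (K - y)]. As [u ^+ k >= 1],
    it propagates to [K - y u^(k+1) <= a (K - y u^k)], and [hitdD] absorbs the factor [a] at each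
    level. *)
Lemma hitd_put beta u K y k : 0 < beta -> 1 < u -> 0 < y -> y <= K ->
  (1 - hitd beta p 0 1) * K <= (u - hitd beta p 0 1) * y ->
  Num.max (K - y * u ^+ k) 0 <= hitd beta p 0 k * (K - y).
Proof.
move=> b0 u1 y0 yK hy; rewrite ge_max; apply/andP; split; last first.
  by rewrite mulr_ge0 ?hitd_ge0 // subr_ge0.
elim: k => [|k IH]; first by rewrite expr0 mulr1 hitd0 // hdisc0 mul1r.
set a := hitd beta p 0 1 in hy.
have a0 : 0 < a := hitd1_gt0 b0.
have a1 : a < 1 := hitd1_lt1 b0.
apply: (@le_trans _ _ (a * hitd beta p 0 k * (K - y))); last first.
  by rewrite ler_wpM2r ?subr_ge0 // -add1n hitdD.
have uk : 1 <= u ^+ k by rewrite exprn_ege1 // ltW.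
apply: (@le_trans _ _ (a * (K - y * u ^+ k))); last by rewrite -mulrA ler_pM2l.
have : (u - a) * y * 1 <= (u - a) * y * u ^+ k.
  by rewrite ler_pM2l // mulr_gt0 // subr_gt0 (lt_trans a1).
rewrite exprS mulr1; set U := u ^+ k; set ua := (u - a) * y in hy *.
have -> : ua * U = y * (u * U) - a * (y * U) by rewrite /ua; ring.
lra.
Qed.

(* The increments of [e] never become positive again once they are nonpositive;
   freezing [e] at its first maximum gives the excessive majorant. *)
Lemma excessive_majorant (e : nat -> R) : e 0 = 0 -> 0 < e 1 ->
  (forall k, p * e k.+2 + (1 - p) * e k <= e k.+1) ->
  exists m : nat -> R, [/\ m 1 = e 1, forall k, 0 <= m k, forall k, e k <= m k &
    forall k, p * m k.+2 + (1 - p) * m k <= m k.+1].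
Proof.
move=> e0 e1 he.
have [ex|nex] := pselect (exists k, e k.+1 <= e k); last first.
  have inc k : e k <= e k.+1.
    by rewrite leNgt; apply/negP => /ltW h; apply: nex; exists k.
  exists e; split=> //; elim=> [|k IH]; first by rewrite e0.
  exact: le_trans IH (inc k).
case: (ex_minnP ex) => ks hks min_ks.
have ks0 : (0 < ks)%N.
  by rewrite lt0n; apply/eqP => h; move: hks; rewrite h e0 leNgt e1.
have inc k : (k < ks)%N -> e k <= e k.+1.
  by move=> kk; rewrite leNgt; apply/negP => /ltW /min_ks; rewrite leqNgt kk.
(* The hypothesis reads [p (e k.+2 - e k.+1) <= (1 - p) (e k.+1 - e k)], so a nonpositive increment
   makes the next one nonpositive. *)
have dec k : (ks <= k)%N -> e k.+1 <= e k.
  elim: k => [|k IH]; first by rewrite leqn0 => /eqP h; move: ks0; rewrite h.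
  rewrite leq_eqVlt => /predU1P[<- //|]; rewrite ltnS => /IH h.
  rewrite -(ler_pM2l p0); have := he k.
  by have := ler_wpM2l (ltW q0) h; lra.
exists (fun k => e (minn k ks)); split.
- by rewrite (minn_idPl ks0).
- elim=> [|k IH]; first by rewrite min0n e0.
  apply: le_trans IH _; case: (ltnP k ks) => h.
    by rewrite (minn_idPl h) inc.
  by rewrite (minn_idPr _) // leqW.
- move=> k; case: (leqP k ks) => // h.
  rewrite -(subnKC (ltnW h)); elim: (k - ks)%N => [|j IH]; first by rewrite addn0.
  by apply: le_trans IH; rewrite addnS dec // leq_addr.
- move=> k; case: (ltngtP k.+1 ks) => h.
  + rewrite (minn_idPl h) (minn_idPl (ltnW (ltnW h))).
    exact: he.
  + rewrite (minn_idPr (leqW (ltnW h))).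
    have hk : e (minn k ks) <= e ks.
      move: h; rewrite ltnS leq_eqVlt => /predU1P[->|/ltnW h]; rewrite ?minnn //.
      by rewrite (minn_idPr h).
    by have := ler_wpM2l (ltW q0) hk; lra.
  + rewrite (minn_idPr _) -?h // (minn_idPl (leqnSn _)).
    have := inc k; rewrite -h ltnSn => /(_ isT) hk.
    by have := ler_wpM2l (ltW q0) hk; lra.
Qed.

End DiscountedHitting.

(** * Integrals over a binary tree of events *)

Section EventTree.
Context {d : measure_display} {Omega : measurableType d} {R : realType}.
Variables (P : probability Omega R) (p : R) (A : seq bool -> set Omega).
Hypotheses (p0 : 0 < p) (p1 : p < 1).
Hypothesis mA : forall b, measurable (A b).
Hypothesis subA : forall b c, A (rcons b c) `<=` A b.
Hypothesis disjA : forall b, A (rcons b true) `&` A (rcons b false) = set0.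
Hypothesis PA : forall b c,
  P (A (rcons b c)) = (P (A b) * (if c then p else 1 - p)%:E)%E.

(** The children are disjoint and their masses add up to that of [A b], so the part of [A b] that
    they miss is null. *)
Lemma tree_integral_split b (F : Omega -> \bar R) :
  measurable_fun setT F -> (forall w, 0 <= F w)%E ->
  (\int[P]_(w in A b) F w =
   \int[P]_(w in A (rcons b true)) F w + \int[P]_(w in A (rcons b false)) F w)%E.
Proof.
move=> mF F0.
set C := A (rcons b true) `|` A (rcons b false).
have mC : measurable C by exact: measurableU.
have CA : C `<=` A b by move=> w [] /subA.
have PC : P C = P (A b).
  transitivity (P (A (rcons b true)) + P (A (rcons b false)))%E; first exact: measureU.
  rewrite !PA /= -muleDr // -?EFinD ?fin_num_measure //.
  by rewrite addrC subrK mule1.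
rewrite (@ge0_negligible_integral _ _ _ P _ (A b `\` C)) //; first last.
- transitivity (P (A b) - P (A b `&` C))%E.
    by apply: measureD => //; rewrite ltey_eq fin_num_measure.
  by rewrite (setIidr CA) PC subee // fin_num_measure.
- exact: measurable_funTS.
- exact: measurableD.
rewrite setDD (setIidr CA) ge0_integral_setU //.
  exact: measurable_funTS.
exact/disj_set2P.
Qed.

(* [D] collects the nodes that are not preceded by a stopped node. *)
Lemma tree_integral_le (g : seq bool -> R) (D : set (seq bool))
    (theta : Omega -> xtime) (F : Omega -> R) b :
  (forall n, measurable [set w | theta w = Some n]) ->
  measurable_fun setT F -> (forall w, 0 <= F w) ->
  (forall w, theta w = None -> F w = 0) ->
  (forall b, D b -> 0 <= g b) ->
  (forall b, D b ->
    (forall w, A b w -> F w <= g b) \/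
    [/\ forall w, A b w -> ~~ xtime_le (theta w) (Some (size b)),
        forall c, D (rcons b c) &
        p * g (rcons b true) + (1 - p) * g (rcons b false) <= g b]) ->
  D b -> (\int[P]_(w in A b) (F w)%:E <= P (A b) * (g b)%:E)%E.
Proof.
move=> mtheta mF F0 Fnone g0 step Db.
have mle n : measurable [set w | xtime_le (theta w) (Some n)].
  rewrite [X in measurable X](_ : _ = \bigcup_(m in `I_n.+1) [set w | theta w = Some m]).
    exact: bigcup_measurable.
  apply/seteqP; split=> w /=; last by move=> [m /= mn ->].
  by case th : (theta w) => [m|] //= mn; exists m.
(* [Fn n] keeps only what is paid by date [n], which makes backward induction possible. *)
pose Fn n w := (F w * (\1_[set w | xtime_le (theta w) (Some n)] w))%:E.
have mFn n : measurable_fun setT (Fn n).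
  apply/measurable_EFinP; apply: measurable_funM => //.
have Fn0 n w : (0 <= Fn n w)%E by rewrite lee_fin mulr_ge0.
have FnF n w : (Fn n w <= (F w)%:E)%E.
  by rewrite lee_fin ler_piMr // indicE; case: (_ \in _).
have Fn_homo n m w : (n <= m)%N -> (Fn n w <= Fn m w)%E.
  move=> nm; rewrite lee_fin ler_wpM2l // !indicE.
  case: (boolP (w \in _)); rewrite ?ler0n // inE /= => h.
  rewrite mem_set //=; case: (theta w) h => //= k /leq_trans; exact.
have cst_bound n b' : (forall w, A b' w -> F w <= g b') -> D b' ->
    (\int[P]_(w in A b') Fn n w <= P (A b') * (g b')%:E)%E.
  move=> h Db'; rewrite muleC -integral_cst //; apply: ge0_le_integral => //.
  - exact: measurable_funTS.
  - by move=> w Aw; rewrite (le_trans (FnF n w)) // lee_fin h.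
(* Here [n] counts the remaining steps: a node at depth [size b'] has horizon [n + size b'], and its
   children share that horizon with one step less to go. *)
have bound n : forall b', D b' ->
    (\int[P]_(w in A b') Fn (n + size b')%N w <= P (A b') * (g b')%:E)%E.
  elim: n => [|n IH] b' Db'; case: (step b' Db') => [h|[hs hD hg]]; try exact: cst_bound.
    rewrite integral0_eq; first by rewrite mule_ge0 // lee_fin g0.
    by move=> w /hs /negbTE hw; rewrite /Fn add0n indicE memNset ?mulr0 //= hw.
  rewrite tree_integral_split //.
  have hc c := IH _ (hD c).
  have e c : (n + size (rcons b' c) = n.+1 + size b')%N.
    by rewrite size_rcons addnS addSn.
  have := leeD (hc true) (hc false); rewrite !e => /le_trans; apply.
  rewrite !PA /= -!muleA -muleDr ?fin_num_measure // -!EFinM -EFinD.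
  by rewrite lee_pmul // ?lee_fin // addr_ge0 // mulr_ge0 ?g0 // ?subr_ge0 ltW.
(* Nothing is lost in the limit, since [F] vanishes where [theta] is infinite. *)
have -> : (\int[P]_(w in A b) (F w)%:E)%E =
    (\int[P]_(w in A b) limn (Fn ^~ w))%E.
  apply: eq_integral => w _; apply/esym/cvg_lim => //.
  apply: cvg_near_cst.
  case th : (theta w) => [m|].
    exists m => // n /= mn; rewrite /Fn indicE mem_set ?mulr1 //=.
    by rewrite th.
  by apply: nearW => n; rewrite /Fn Fnone // mul0r.
rewrite monotone_convergence //; first last.
- by move=> w _ n m; exact: Fn_homo.
- by move=> n; exact: measurable_funTS.
apply: lime_le.
  apply: ereal_nondecreasing_is_cvgn => n m nm; apply: ge0_le_integral => //.
  - exact: measurable_funTS.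
  - exact: measurable_funTS.
  - by move=> w _; exact: Fn_homo.
apply: nearW => n; apply: le_trans (bound n b Db).
apply: ge0_le_integral => //; try exact: measurable_funTS.
by move=> w _; apply: Fn_homo; rewrite leq_addr.
Qed.

(** [g n b] is what is guaranteed within [n] further steps. It is 0 at [n = 0], where [F >= 0]
    starts an induction on the horizon. *)
Lemma tree_integral_ge (g : nat -> seq bool -> R) (D : set (seq bool))
    (F : Omega -> R) n b :
  measurable_fun setT F -> (forall w, 0 <= F w) ->
  (forall b, D b -> g 0 b = 0) ->
  (forall n b, D b -> 0 <= g n b) ->
  (forall n b, D b ->
    (forall w, A b w -> g n.+1 b <= F w) \/
    ((forall c, D (rcons b c)) /\
     g n.+1 b <= p * g n (rcons b true) + (1 - p) * g n (rcons b false))) ->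
  D b -> (P (A b) * (g n b)%:E <= \int[P]_(w in A b) (F w)%:E)%E.
Proof.
move=> mF F0 g0 g_ge0 step; have mF' : measurable_fun setT (EFin \o F) by exact/measurable_EFinP.
elim: n b => [|n IH] b Db.
  by rewrite g0 // mule0; apply: integral_ge0 => w _; rewrite lee_fin.
case: (step n b Db) => [h|[hD hg]].
  rewrite muleC -integral_cst //.
  apply: ge0_le_integral => //; last exact: measurable_funTS.
  by move=> w _; rewrite lee_fin g_ge0.
rewrite tree_integral_split //.
apply: le_trans (leeD (IH _ (hD true)) (IH _ (hD false))).
rewrite !PA /= -!muleA -muleDr ?fin_num_measure // -!EFinM -EFinD.
by rewrite lee_wpmul2l // lee_fin.
Qed.

End EventTree.

(** * Space-time bounds for the integer walk *)

Section IntegerWalk.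
Context {d : measure_display} {Omega : measurableType d} {R : realType}.
Variables (P : probability Omega R) (p : R) (Z : nat -> Omega -> int) (k0 : nat).

Definition position (b : seq bool) : int :=
  k0%:Z + \sum_(c <- b) (if c then 1 else -1).

Definition path_event (b : seq bool) : set Omega :=
  [set w | forall j, (j <= size b)%N -> Z j w = position (take j b)].

Lemma position_nil : position [::] = k0%:Z.
Proof. by rewrite /position big_nil addr0. Qed.

Lemma position_rcons b c :
  position (rcons b c) = position b + (if c then 1 else -1).
Proof. by rewrite /position -cats1 big_cat big_seq1 addrA. Qed.

Lemma take_rcons_le b (c : bool) j : (j <= size b)%N -> take j (rcons b c) = take j b.
Proof. by move=> jb; rewrite -cats1 takel_cat. Qed.

Lemma path_event_nil : path_event [::] = [set w | Z 0%N w = k0%:Z].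
Proof.
apply/seteqP; split=> w /=; first by move=> /(_ 0%N isT); rewrite position_nil.
by move=> Zw [|//] _; rewrite position_nil.
Qed.

Lemma path_event_last b w : path_event b w -> Z (size b) w = position b.
Proof. by move=> /(_ _ (leqnn _)); rewrite take_size. Qed.

Lemma path_event_rcons b c : path_event (rcons b c) `<=` path_event b.
Proof.
move=> w h j jb; rewrite h; first by rewrite take_rcons_le.
by rewrite size_rcons (leq_trans jb).
Qed.

Lemma path_event_disj b :
  path_event (rcons b true) `&` path_event (rcons b false) = set0.
Proof.
apply/seteqP; split=> w //= [/path_event_last + /path_event_last].
by rewrite !size_rcons => -> /eqP; rewrite !position_rcons (inj_eq (addrI _)).
Qed.

Lemma path_event_agree b w w' : path_event b w -> path_event b w' ->
  forall j, (j <= size b)%N -> Z j w = Z j w'.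
Proof. by move=> h h' j jb; rewrite h // h'. Qed.

Hypotheses (p0 : 0 < p) (p1 : p < 1).
Hypothesis mZ : forall t z, measurable [set w | Z t w = z].
Hypothesis PZ : forall b c, P (path_event (rcons b c)) =
  (P (path_event b) * (if c then p else 1 - p)%:E)%E.

Lemma measurable_path_event b : measurable (path_event b).
Proof.
rewrite [X in measurable X](_ : _ =
    \bigcap_(j in `I_(size b).+1) [set w | Z j w = position (take j b)]).
  by apply: bigcap_measurable => //; exists 0%N.
by apply/seteqP; split=> w h j /h.
Qed.

(** Optional stopping for a space-time supermartingale [G]. Excessivity is asked at positive heights
    only, because the last hypothesis makes [theta] stop no later than a visit to 0. The agreement
    hypothesis makes stopping a property of the tree node. *)
Lemma walk_integral_le (G : nat -> nat -> R) (theta : Omega -> xtime)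
    (F : Omega -> R) : (0 < k0)%N ->
  (forall n, measurable [set w | theta w = Some n]) ->
  measurable_fun setT F -> (forall w, 0 <= F w) ->
  (forall w, theta w = None -> F w = 0) ->
  (forall t k, 0 <= G t k) ->
  (forall t k, p * G t.+1 k.+2 + (1 - p) * G t.+1 k <= G t k.+1) ->
  (forall w w' t, (forall j, (j <= t)%N -> Z j w = Z j w') ->
    theta w = Some t -> theta w' = Some t) ->
  (forall w t k, Z 0%N w = k0%:Z -> theta w = Some t -> Z t w = k%:Z -> F w <= G t k) ->
  (forall w t, (0 < t)%N -> Z t w = 0 -> xtime_le (theta w) (Some t)) ->
  (\int[P]_(w in [set w | Z 0%N w = k0%:Z]) (F w)%:E <=
   P [set w | Z 0%N w = k0%:Z] * (G 0%N k0)%:E)%E.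
Proof.
move=> k0_gt0 mtheta mF F0 Fnone G0 excG sat pay stop.
pose g b := G (size b) `|position b|%N.
pose D : set (seq bool) := [set b | 0 <= position b /\
  forall w, path_event b w -> forall s, (s < size b)%N -> theta w <> Some s].
have -> : G 0%N k0 = g [::] by rewrite /g position_nil.
rewrite -path_event_nil.
apply: (tree_integral_le p0 p1 measurable_path_event path_event_rcons
  path_event_disj PZ (D := D) mtheta mF F0 Fnone) => //=.
- by move=> b _; exact: G0.
- move=> b [posb alive].
  (* If one path through the node has stopped by now, it stops exactly now, since no earlier node
     was stopped; by [sat] all paths through the node then stop now. *)
  have [[w [bw thw]]|nostop] :=
      pselect (exists w, path_event b w /\ xtime_le (theta w) (Some (size b))).
    left=> w' bw'.
    have {}thw : theta w = Some (size b).
      case th : (theta w) thw => [s|//] /=; rewrite leq_eqVlt => /predU1P[-> //|sb].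
      by have := alive w bw s sb th.
    have thw' := sat _ _ _ (path_event_agree bw bw') thw.
    apply: pay => //.
      by rewrite (bw' 0%N) // take0 position_nil.
    by rewrite (path_event_last bw') gez0_abs.
  have [[w bw]|empty] := pselect (exists w, path_event b w); last first.
    by left=> w bw; case: empty; exists w.
  (* An unstopped node at height 0 would contradict [stop]. The root, about which [stop] says
     nothing, sits at [k0 > 0]. *)
  right; have pb : 0 < position b.
    rewrite lt_neqAle posb andbT; apply/eqP => pb0.
    case: (posnP (size b)) => sb.
      move: pb0; rewrite (size0nil sb) position_nil => -[k00].
      by move: k0_gt0; rewrite -k00.
    by apply: nostop; exists w; split=> //; apply: stop; rewrite // path_event_last.
  split.
  + by move=> w' bw'; apply/negP => thw'; apply: nostop; exists w'.
  + move=> c; split; first by rewrite position_rcons; case: c; lia.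
    move=> w' /path_event_rcons bw' s; rewrite size_rcons ltnS => sb th.
    by apply: nostop; exists w'; rewrite th.
  + rewrite /g !size_rcons !position_rcons.
    case: (position b) pb => // -[//|k] _.
    have -> : `|(k.+1%:Z + 1)%R|%N = k.+2 by lia.
    have -> : `|(k.+1%:Z - 1)%R|%N = k by lia.
    exact: excG.
- by rewrite /D /= position_nil; split.
Qed.

(** A node at a first visit to 0 guarantees [C * hdisc beta t]; before it, the recursion of [hitn]
    is the tree recursion. The bounds for all horizons then pass to [hitd]. *)
Lemma walk_integral_ge (beta C : R) (F : Omega -> R) : 0 < beta -> 0 <= C ->
  measurable_fun setT F -> (forall w, 0 <= F w) ->
  (forall w t, Z 0%N w = k0%:Z -> Z t w = 0 -> (forall j, (j < t)%N -> 0 < Z j w) ->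
    C * hdisc beta t <= F w) ->
  (P [set w | Z 0%N w = k0%:Z] * (C * hitd beta p 0 k0)%:E <=
   \int[P]_(w in [set w | Z 0%N w = k0%:Z]) (F w)%:E)%E.
Proof.
move=> b0 C0 mF F0 pay; rewrite -path_event_nil.
pose g n b := C * hitn beta p n (size b) `|position b|%N.
pose D : set (seq bool) := [set b | 0 <= position b /\
  forall s, (s < size b)%N -> 0 < position (take s b)].
have bound n : (P (path_event [::]) * (C * hitn beta p n 0 k0)%:E <=
    \int[P]_(w in path_event [::]) (F w)%:E)%E.
  have -> : C * hitn beta p n 0 k0 = g n [::] by rewrite /g position_nil.
  apply: (tree_integral_ge measurable_path_event path_event_rcons
    path_event_disj PZ (g := g) (D := D) n mF F0).
  - by move=> b _; rewrite /g mulr0.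
  - by move=> m b _; rewrite /g mulr_ge0 // hitn_ge0.
  - move=> m b [posb alive]; have [pb0|pb] := eqVneq (position b) 0.
      left=> w bw; rewrite /g pb0; apply: pay.
      + by rewrite (bw 0%N) // take0 position_nil.
      + by rewrite path_event_last.
      + by move=> j jb; rewrite bw ?alive // ltnW.
    right; split.
      move=> c; split; first by rewrite position_rcons; case: c; lia.
      move=> s; rewrite size_rcons ltnS => sb; rewrite take_rcons_le //.
      move: sb; rewrite leq_eqVlt => /predU1P[->|/alive //].
      by rewrite take_size; lia.
    rewrite /g !size_rcons !position_rcons.
    case: (position b) posb pb => // -[//|k] _ _.
    have -> : `|(k.+1%:Z + 1)%R|%N = k.+2 by lia.
    have -> : `|(k.+1%:Z - 1)%R|%N = k by lia.
    by rewrite mulrDr !(mulrCA C).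
  - by rewrite /D /= position_nil; split.
have Pfin : P (path_event [::]) \is a fin_num.
  by apply: fin_num_measure; exact: measurable_path_event.
(* Only a finite integral needs an argument: divide by the mass times [C] when this is positive,
   then apply [hitd_ub]. *)
case: (\int[P]_(w in _) _)%E bound => [r bound|_|/(_ 0%N)]; first 1 last.
- by rewrite leey.
- by rewrite /= mulr0 mule0.
rewrite -(fineK Pfin) -EFinM lee_fin mulrA.
have PC : 0 <= fine (P (path_event [::])) * C by rewrite mulr_ge0 // fine_ge0.
move: PC; rewrite le_eqVlt => /predU1P[<-|PC].
  by rewrite mul0r; have := bound 0%N; rewrite /= mulr0 mule0 lee_fin.
rewrite mulrC -ler_pdivlMr //; apply: hitd_ub => // n.
rewrite ler_pdivlMr // mulrC -mulrA -lee_fin EFinM fineK //.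
Qed.

End IntegerWalk.

(** * First dates of a set and measurability at random times *)

Section ExtendedTimes.

Lemma xtime_inf_SomeP (A : set nat) n :
  xtime_inf A = Some n <-> A n /\ forall k, (k < n)%N -> ~ A k.
Proof.
rewrite /xtime_inf; case: pselect => [ex|nex]; last first.
  by split=> // -[An _]; case: nex; exists n; apply/asboolP.
case: (ex_minnP ex) => m /asboolP Am mmin; split.
  move=> [<-]; split=> // k km Ak.
  by move: km; rewrite ltnNge mmin //; apply/asboolP.
move=> [An nmin]; congr Some; apply/eqP; rewrite eqn_leq mmin; last exact/asboolP.
by rewrite leqNgt; apply/negP => /nmin.
Qed.

Lemma xtime_inf_NoneP (A : set nat) : xtime_inf A = None <-> forall k, ~ A k.
Proof.
split=> [h k Ak|h]; last first.
  by case e : (xtime_inf A) => [n|//]; have [/h] := (xtime_inf_SomeP A n).1 e.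
move: h; rewrite /xtime_inf; case: pselect => // nex _.
by apply: nex; exists k; apply/asboolP.
Qed.

Lemma xtime_inf_leP (A : set nat) n :
  xtime_le (xtime_inf A) (Some n) <-> exists2 k, (k <= n)%N & A k.
Proof.
split=> [|[k kn Ak]].
  by case e : (xtime_inf A) => [m|//] /= mn; exists m; have [] := (xtime_inf_SomeP A m).1 e.
case e : (xtime_inf A) => [m|]; last by have := (xtime_inf_NoneP A).1 e k.
rewrite /= (leq_trans _ kn) // leqNgt; apply/negP => km.
by have [_ /(_ k km)] := (xtime_inf_SomeP A m).1 e.
Qed.

Context {d : measure_display} {Omega : measurableType d} {R : realType}.

Lemma measurable_xtime_inf (A : Omega -> set nat) n :
  (forall k, measurable [set w | A w k]) ->
  measurable [set w | xtime_inf (A w) = Some n].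
Proof.
move=> mA; rewrite [X in measurable X](_ : _ = [set w | A w n] `&`
    \bigcap_k ((if (k < n)%N then ~` [set w | A w k] else setT))).
  apply: measurableI => //; apply: bigcapT_measurable => k.
  by case: ifP => // _; exact: measurableC.
apply/seteqP; split=> w /=.
  by move=> /xtime_inf_SomeP[An nmin]; split=> // k _; case: ifP => // /nmin.
move=> [An nmin]; apply/xtime_inf_SomeP; split=> // k kn.
by have := nmin k I; rewrite kn.
Qed.

Lemma measurable_fun_xtime (theta : Omega -> xtime) (H : xtime -> Omega -> R) :
  (forall n, measurable [set w | theta w = Some n]) ->
  (forall s, measurable_fun setT (H s)) ->
  measurable_fun setT (fun w => H (theta w) w).
Proof.
move=> mt mH _ B mB; rewrite setTI.
have mN : measurable [set w | theta w = None].
  rewrite [X in measurable X](_ : _ = ~` \bigcup_n [set w | theta w = Some n]).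
    by apply: measurableC; exact: bigcupT_measurable.
  apply/seteqP; split=> w /=; first by move=> e [n _ /=]; rewrite e.
  by case e : (theta w) => [m|//] h; exfalso; apply: h; exists m.
rewrite [X in measurable X](_ : _ =
    ([set w | theta w = None] `&` (H None @^-1` B)) `|`
    \bigcup_n ([set w | theta w = Some n] `&` (H (Some n) @^-1` B))).
  have mHB s : measurable (H s @^-1` B) by rewrite -[X in measurable X]setTI; exact: mH.
  apply: measurableU; first exact: measurableI.
  by apply: bigcupT_measurable => n; exact: measurableI.
apply/seteqP; split=> w /=.
  by case e : (theta w) => [n|] h; [right; exists n | left].
by case=> [[-> //]|[n _] /= [-> //]].
Qed.

End ExtendedTimes.

(** * Identification of [alpha1] with the discounted hitting value *)

Section HittingTransform.
Context {d : measure_display} {Omega : measurableType d} {R : realType}.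
Variables (Q : probability Omega R) (p : R) (Y : nat -> Omega -> int).
Hypotheses (p0 : 0 < p) (p1 : p < 1) (hY : random_walk p Q Y).

Lemma path_event_increments b : path_event Y 1 b =
  [set w | Y 0%N w = 1 /\ forall k, (k < size b)%N ->
    Y k.+1 w - Y k w = if nth false b k then 1 else -1].
Proof.
apply/seteqP; split=> w /= h.
  split=> [|k kb]; first by rewrite (h 0%N) // take0 position_nil.
  rewrite (h k.+1) // (h k) ?(ltnW kb) // (take_nth false kb) position_rcons.
  by rewrite addrC addKr.
case: h => Y0 h j; elim: j => [|j IH] jb; first by rewrite take0 position_nil.
rewrite (take_nth false jb) position_rcons -IH ?(ltnW jb) // -h //.
by rewrite addrC subrK.
Qed.

Lemma walk_path_event b c : Q (path_event Y 1 (rcons b c)) =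
  (Q (path_event Y 1 b) * (if c then p else 1 - p)%:E)%E.
Proof.
rewrite !path_event_increments (hY.2 (size (rcons b c)) 1
  (fun k => if nth false (rcons b c) k then 1 else -1)).
rewrite (hY.2 (size b) 1 (fun k => if nth false b k then 1 else -1)).
rewrite size_rcons big_ord_recr /= nth_rcons ltnn eqxx EFinM -muleA.
congr (_ * (_ * _))%E.
  by congr EFin; apply: eq_bigr => k _; rewrite nth_rcons ltn_ord.
by case: c.
Qed.

(** For [G = hitd beta p], harmonic by [hitdS], the upper and lower walk bounds coincide. The
    integral over [Y 0 = 1] is thus the mass of that event times [hitd beta p 0 1], and the mass
    cancels in the conditional expectation. *)
Lemma alpha1E (beta : R) : 0 < beta -> (0 < Q [set w | Y 0%N w = 1%R])%E ->
  alpha1 beta Q Y = hitd beta p 0 1.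
Proof.
move=> b0 Q0; set A := [set w | Y 0%N w = 1].
have mY t z : measurable [set w | Y t w = z] by exact: hY.1.
pose F w : R := if walk_hit0 Y w is Some t then hdisc beta t else 0.
have mtheta n : measurable [set w | walk_hit0 Y w = Some n].
apply: measurable_xtime_inf => k; exact: mY.
have F0 w : 0 <= F w by rewrite /F; case: walk_hit0 => // t; exact/ltW/hdisc_gt0.
have mF : measurable_fun setT F.
  apply: (measurable_fun_xtime
    (H := fun s _ => if s is Some t then hdisc beta t else 0)) => //.
have QA : Q A \is a fin_num by apply: fin_num_measure; exact: mY.
have int : (\int[Q]_(w in A) (F w)%:E = Q A * (hitd beta p 0 1)%:E)%E.
  apply/eqP; rewrite eq_le; apply/andP; split.
    apply: (walk_integral_le p0 p1 mY walk_path_event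
      (theta := walk_hit0 Y) (G := hitd beta p)) => //.
    - by move=> w; rewrite /F => ->.
    - by move=> t k; exact: hitd_ge0.
    - by move=> t k; rewrite -hitdS.
    - move=> w w' t h /xtime_inf_SomeP[Yt tmin]; apply/xtime_inf_SomeP; split.
        by rewrite /= -h.
      by move=> k kt; rewrite /= -h ?(ltnW kt) //; exact: tmin.
    - move=> w t k _ th; have /xtime_inf_SomeP[-> _] := th => -[<-].
      by rewrite /F th hitd0.
    - by move=> w t _ Yt; apply/xtime_inf_leP; exists t.
  rewrite -[hitd _ _ _ _]mul1r.
  apply: (walk_integral_ge p0 p1 mY walk_path_event b0 ler01 mF F0).
  move=> w t _ Yt pos; rewrite mul1r /F.
  have -> // : walk_hit0 Y w = Some t.
  apply/xtime_inf_SomeP; split=> // k kt /= Yk.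
  by have := pos k kt; rewrite Yk.
rewrite /alpha1 /cond_expectation /Rintegral -/A.
rewrite [X in fine X](_ : _ = (Q A * (hitd beta p 0 1)%:E)%E) //.
rewrite fineM // mulrC mulrA mulVf ?mul1r //.
by rewrite gt_eqF // fine_gt0 // Q0 ltey_eq QA.
Qed.

End HittingTransform.

(** * Stopping times of the generated filtration *)

Section StoppingTimes.
Context {d : measure_display} {Omega : measurableType d} {R : realType}.
Variable X : nat -> Omega -> R.

Definition xtime_min (s t : xtime) : xtime :=
  match s, t with
  | Some m, Some n => Some (minn m n)
  | None, _ => t
  | _, None => s
  end.

Lemma xtime_min_le s t n : xtime_le (xtime_min s t) (Some n) =
  xtime_le s (Some n) || xtime_le t (Some n).
Proof. by case: s t => [s|] [t|] //=; rewrite ?geq_min ?orbF. Qed.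

Lemma history_sigma_algebra n : sigma_algebra setT (history X n).
Proof. exact: smallest_sigma_algebra. Qed.

Lemma history_set0 n : history X n set0.
Proof. by have [] := history_sigma_algebra n. Qed.

Lemma history_setT n : history X n setT.
Proof.
by have [h0 hD _] := history_sigma_algebra n; have := hD _ h0; rewrite setD0.
Qed.

Lemma history_setU n A B : history X n A -> history X n B -> history X n (A `|` B).
Proof.
move=> hA hB; have [h0 _ hU] := history_sigma_algebra n.
by rewrite -bigcup2E; apply: hU => -[|[|k]].
Qed.

Lemma history_bigcup n (F : nat -> set Omega) :
  (forall k, history X n (F k)) -> history X n (\bigcup_k F k).
Proof. by have [_ _ hU] := history_sigma_algebra n; exact: hU. Qed.

Lemma history_coord n k (B : set R) : (k <= n)%N -> history X n (X k @^-1` B).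
Proof.
by move=> kn; apply: sub_gen_smallest; exists k; split=> //; exists B.
Qed.

(** Good-set argument: the events that do not separate [w] from [w'] form a sigma-algebra containing
    the generators. *)
Lemma history_agree n A w w' : history X n A ->
  (forall k, (k <= n)%N -> X k w = X k w') -> A w -> A w'.
Proof.
move=> hA agr.
suff : (A w <-> A w') by case.
pose C : set (set Omega) := [set A | A w <-> A w'].
apply: (smallest_sub (X := C) _ _ hA).
  split=> //= [B [h1 h2]|F h].
    by split=> -[_ nB]; split=> //; [move=> /h2|move=> /h1].
  by split=> -[k _ /h Fk]; exists k.
move=> _ [k [kn [B ->]]]; rewrite /C /= agr //.
Qed.

Lemma stopping_time_cst s : stopping_time X (fun=> s).
Proof.
move=> n; case: (boolP (xtime_le s (Some n))) => h.
  rewrite [X in history _ _ X](_ : _ = setT); first exact: history_setT.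
  by apply/seteqP; split.
rewrite [X in history _ _ X](_ : _ = set0); first exact: history_set0.
by apply/seteqP; split=> // w /=; rewrite (negbTE h).
Qed.

(** The filter [c] on dates treats [hit] (all dates) and [hit_pos] (positive dates) together. *)
Lemma stopping_time_inf (S : set R) (c : nat -> bool) :
  stopping_time X (fun w => xtime_inf [set t | c t /\ S (X t w)]).
Proof.
move=> n; rewrite [X in history _ _ X](_ : _ =
    \bigcup_k (if c k && (k <= n)%N then X k @^-1` S else set0)).
  apply: history_bigcup => k; case: ifP => [/andP[_ kn]|_]; last exact: history_set0.
  exact: history_coord.
apply/seteqP; split=> w /=.
  by move=> /xtime_inf_leP[k kn /= [ck SX]]; exists k => //; rewrite ck kn.
move=> [k _]; case: ifP => // /andP[ck kn] SX.
by apply/xtime_inf_leP; exists k.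
Qed.

Lemma stopping_time_hit S : stopping_time X (hit X S).
Proof.
have -> : hit X S = (fun w => xtime_inf [set t | true /\ S (X t w)]).
  by apply/funext => w; congr xtime_inf; apply/seteqP; split=> t //= [].
exact: (stopping_time_inf S xpredT).
Qed.

Lemma stopping_time_hit_pos S : stopping_time X (hit_pos X S).
Proof. exact: (stopping_time_inf S (fun t => 0 < t)%N). Qed.

Lemma stopping_time_min tau sigma : stopping_time X tau -> stopping_time X sigma ->
  stopping_time X (fun w => xtime_min (tau w) (sigma w)).
Proof.
move=> ht hs n; rewrite [X in history _ _ X](_ : _ =
  [set w | xtime_le (tau w) (Some n)] `|` [set w | xtime_le (sigma w) (Some n)]).
  exact: history_setU.
apply/seteqP; split=> w /=; rewrite xtime_min_le; first by move/orP.
by move=> h; apply/orP.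
Qed.

(** The event [theta <= t] transports from [w] to [w'] by [history_agree]; a strictly earlier value
    at [w'] would transport back to [w]. *)
Lemma stopping_time_agree theta w w' t : stopping_time X theta ->
  (forall k, (k <= t)%N -> X k w = X k w') -> theta w = Some t -> theta w' = Some t.
Proof.
move=> ht agr th.
have /= le_t : xtime_le (theta w') (Some t).
  by apply: (history_agree (ht t) agr); rewrite /= th /=.
case th' : (theta w') le_t => [s|//] /=; rewrite leq_eqVlt => /predU1P[-> //|st].
have : xtime_le (theta w) (Some s).
  apply: (history_agree (w := w') (ht s)); last by rewrite /= th' /=.
  by move=> k ks; rewrite agr // (leq_trans ks) // ltnW.
by rewrite th /= leqNgt st.
Qed.

Hypothesis mX : forall k (B : set R), measurable (X k @^-1` B).

Lemma history_measurable n A : history X n A -> measurable A.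
Proof.
apply: smallest_sub; first exact: sigma_algebra_measurable.
by move=> _ [k [_ [B ->]]].
Qed.

Lemma stopping_time_measurable theta n : stopping_time X theta ->
  measurable [set w | theta w = Some n].
Proof.
move=> ht; rewrite [X in measurable X](_ : _ = [set w | xtime_le (theta w) (Some n)]
   `\` \bigcup_(k in `I_n) [set w | xtime_le (theta w) (Some k)]).
  apply: measurableD; first exact: history_measurable (ht n).
  by apply: bigcup_measurable => k _; exact: history_measurable (ht k).
apply/seteqP; split=> w /=.
  move=> th; split; first by rewrite th /=.
  by move=> [k /= kn]; rewrite th /= leqNgt kn.
move=> [h1 h2]; case th : (theta w) h1 => [m|//] /=.
rewrite leq_eqVlt => /predU1P[-> //|mn]; exfalso; apply: h2.
by exists m => //=; rewrite th /=.
Qed.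

End StoppingTimes.

(** * The chain in logarithmic coordinates *)

Section NegotiationChain.
Context {d : measure_display} {Omega : measurableType d} {R : realType}.
Variables (u p : R) (P : R -> probability Omega R) (X : nat -> Omega -> R).
Hypotheses (hu : 1 < u) (p0 : 0 < p) (p1 : p < 1).
Hypothesis hX : markov_chain (states u) (transition u p) P X.

Let u0 : 0 < u. Proof. exact: lt_trans hu. Qed.
Let un0 : u != 0. Proof. by rewrite gt_eqF. Qed.

Lemma states_gt0 x : states u x -> 0 < x.
Proof. by move=> [j _ <-]; exact: exprz_gt0. Qed.

Lemma states_mulz x j : states u x -> states u (x * u ^ j).
Proof. by move=> [i _ <-]; exists (i + j) => //; rewrite expfzDr. Qed.

Lemma states_mul x k : states u x -> states u (x * u ^+ k).
Proof. exact: (@states_mulz x k). Qed.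

Lemma states_div x : states u x -> states u (x / u).
Proof. exact: (@states_mulz x (-1)). Qed.

Lemma states_ratio x y : states u x -> states u y -> exists j : int, x = y * u ^ j.
Proof.
move=> [i _ <-] [j _ <-]; exists (i - j).
by rewrite -expfzDr // addrC subrK.
Qed.

(** The signed number of steps from [y] up to [x], so that any state [y] can serve as origin. The
    default 0 does not intervene between two states, whose ratio is a power of [u]. *)
Definition log_ratio (y x : R) : int := xget 0 [set j : int | x = y * u ^ j].

Lemma log_ratioE y j : 0 < y -> log_ratio y (y * u ^ j) = j.
Proof.
move=> y0; apply: xget_unique => //= i /(mulfI (lt0r_neq0 y0)).
by move=> /(ieexprIz u0); rewrite gt_eqF // => ->.
Qed.

Lemma log_ratioK y x : states u x -> states u y -> x = y * u ^ log_ratio y x.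
Proof. by move=> sx sy; have [j ->] := states_ratio sx sy; rewrite log_ratioE ?states_gt0. Qed.

(** An arbitrary [B] is allowed because [X k] takes countably many values, each on a measurable
    event. *)
Lemma measurable_coord k (B : set R) : measurable (X k @^-1` B).
Proof.
have [mX sX _ _] := hX.
rewrite [X in measurable X](_ : _ = \bigcup_(j : int)
    ((X k @^-1` [set u ^ j]) `&` (if `[< B (u ^ j) >] then setT else set0))).
  apply: countable_bigcupT_measurable => [|j]; first exact: countableP.
  apply: measurableI; last by case: ifP.
  by rewrite -[X in measurable X]setTI; apply: mX.
apply/seteqP; split=> w /=.
  have [j _ e] := sX k w => Bj; exists j => //; split=> //.
  by rewrite ifT //; apply/asboolP; rewrite e.
by move=> [j _ [/= ->]]; case: ifP => // /asboolP.
Qed.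

Lemma measurable_fun_coord k (f : R -> R) : measurable_fun setT (fun w => f (X k w)).
Proof. by move=> _ B _; rewrite setTI; exact: (measurable_coord k (f @^-1` B)). Qed.

Section LogWalk.
Variables (y : R) (k0 : nat).
Hypothesis sy : states u y.

Let Z t w : int := log_ratio y (X t w).

Lemma coord_log t w : X t w = y * u ^ (log_ratio y (X t w)).
Proof. by have [_ sX _ _] := hX; exact: log_ratioK. Qed.

Lemma log_coordE t w z : Z t w = z <-> X t w = y * u ^ z.
Proof.
split=> [<-|h]; first exact: coord_log.
by rewrite /Z h log_ratioE // states_gt0.
Qed.

Lemma log_path_event b : path_event Z k0 b =
  [set w | forall j, (j <= size b)%N -> X j w = y * u ^ position k0 (take j b)].
Proof. by apply/seteqP; split=> w h j jb; apply/log_coordE; exact: h. Qed.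

Lemma log_walk_law b c : let P' := P (y * u ^+ k0) in
  P' (path_event Z k0 (rcons b c)) =
  (P' (path_event Z k0 b) * (if c then p else 1 - p)%:E)%E.
Proof.
have [_ _ _ hP] := hX; rewrite /= !log_path_event size_rcons.
pose s j := y * u ^ position k0 (take j (rcons b c)).
rewrite (hP _ (states_mul k0 sy) (size b) s); congr (_ * _)%E.
  congr (P _ _); apply/seteqP; split=> w /= h j jb; rewrite h //.
    by rewrite /s take_rcons_le.
  by rewrite /s take_rcons_le.
have -> : s (size b) = y * u ^ position k0 b by rewrite /s take_rcons_le // take_size.
have -> : s (size b).+1 = y * u ^ (position k0 b + (if c then 1 else -1)).
  by rewrite /s -(size_rcons b c) take_size position_rcons.
congr EFin; rewrite /transition.
have -> : y * u ^ (position k0 b + (if c then 1 else -1)) / (y * u ^ position k0 b) =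
    if c then u else u^-1.
  rewrite expfzDr // mulrA mulrAC divff; last first.
    by rewrite mulf_neq0 // lt0r_neq0 ?exprz_gt0 // states_gt0.
  by rewrite mul1r; case: (c).
(* For a down-step the first test of [transition] must fail, which follows from [u^-1 < 1 < u]. *)
case: (c); first by rewrite eqxx.
rewrite eqxx ifF //; apply/negbTE; rewrite lt_eqF //.
by rewrite (lt_trans _ hu) // invf_lt1.
Qed.

Lemma log_start : [set w | Z 0%N w = k0%:Z] = [set w | X 0%N w = y * u ^+ k0].
Proof.
apply/seteqP; split=> w /= h; first exact: (log_coordE 0 w k0).1 h.
exact: (log_coordE 0 w k0).2 h.
Qed.

Lemma measurable_log_coord t z : measurable [set w | Z t w = z].
Proof.
rewrite [X in measurable X](_ : _ = X t @^-1` [set y * u ^ z]).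
  exact: measurable_coord.
by apply/seteqP; split=> w /= h; apply/log_coordE.
Qed.

End LogWalk.

End NegotiationChain.

(** * Elementary facts on hitting times *)

Section Hitting.
Context {d : measure_display} {Omega : measurableType d} {R : realType}.
Variable X : nat -> Omega -> R.

Lemma hit_set0 w : hit X set0 w = None.
Proof. by apply/xtime_inf_NoneP => k. Qed.

Lemma hit_pos_set0 w : hit_pos X set0 w = None.
Proof. by apply/xtime_inf_NoneP => k []. Qed.

Lemma hit_start (T : set R) w : T (X 0%N w) -> hit X T w = Some 0%N.
Proof. by move=> TX; apply/xtime_inf_SomeP. Qed.

Lemma hit_start_notin (T : set R) w s :
  ~ T (X 0%N w) -> hit X T w = Some s -> (0 < s)%N.
Proof. by move=> TX /xtime_inf_SomeP[Ts _]; rewrite lt0n; apply/eqP => s0; move: Ts; rewrite s0. Qed.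

Lemma hit_pos_ge1 (S : set R) w : xtime_le (Some 1%N) (hit_pos X S w).
Proof. by case e : (hit_pos X S w) => [s|//]; have /xtime_inf_SomeP[[]] := e. Qed.

Lemma hit_posS (S S' : set R) w : S `<=` S' ->
  xtime_le (hit_pos X S' w) (hit_pos X S w).
Proof.
move=> SS; case e : (hit_pos X S w) => [s|]; last by case: hit_pos.
by apply/xtime_inf_leP; have /xtime_inf_SomeP[[s0 /SS Ss] _] := e; exists s.
Qed.

Definition lower_states (u y : R) : set R := [set x | 0 < x <= y] `&` states u.

Lemma xtime_le_trans t s r : xtime_le r s -> xtime_le s t -> xtime_le r t.
Proof. by case: r s t => [r|] [s|] [t|] //=; exact: leq_trans. Qed.

End Hitting.

(** * Expected payoffs of one firm *)

Section Firm.
Context {d : measure_display} {Omega : measurableType d} {R : realType}.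
Variables (u p : R) (P : R -> probability Omega R) (X : nat -> Omega -> R).
Hypotheses (hu : 1 < u) (p0 : 0 < p) (p1 : p < 1).
Hypothesis hX : markov_chain (states u) (transition u p) P X.
Variables (K N beta : R) (h : R -> R).
Hypotheses (K0 : 0 < K) (KN : K <= N) (b0 : 0 < beta).
Hypothesis hh : forall x, states u x -> Num.max (K - x) 0 <= h x <= N.

Local Notation a := (firm K N beta h).
Local Notation put x := (Num.max (K - x) 0).
Local Notation J := (J P X a).
Local Notation payoff := (payoff X a).
Local Notation alpha k := (hitd beta p 0 k).

Let u0 : 0 < u. Proof. exact: lt_trans hu. Qed.
Let N0 : 0 <= N. Proof. exact: le_trans (ltW K0) KN. Qed.

Let sX t w : states u (X t w).
Proof. by have [_ sX _ _] := hX. Qed.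

Let hpay_ge0 x : states u x -> 0 <= h x.
Proof. by move=> /hh /andP[+ _]; apply: le_trans; rewrite le_max lexx orbT. Qed.

Lemma never_stop_payoff w : limn_sup (fun t => disc a t * hpay a (X t w)) = 0.
Proof.
set v := fun t => _; suff /cvg_limn_inf_sup[_ ->] : v t @[t --> \oo] --> (0 : R) by [].
(* This [c] gives [1 + beta t >= c (t + 1)], so [v] is bounded by a multiple of the harmonic
   sequence. *)
pose c := Num.min 1 beta; have c0 : 0 < c by rewrite lt_min ltr01.
have bound t : 0 <= v t <= N / c * t.+1%:R^-1.
  have [h0 hN] : 0 <= h (X t w) /\ h (X t w) <= N.
    by split; [exact/hpay_ge0|have /andP[] := hh (sX t w)].
  rewrite /v /= mulr_ge0 ?(ltW (hdisc_gt0 t b0)) //=.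
  rewrite mulrC -mulrA ler_pM ?(ltW (hdisc_gt0 t b0)) //.
  rewrite -invfM lef_pV2 ?posrE ?hdisc_den_gt0 ?mulr_gt0 //.
  rewrite mulrSr addrC mulrDr mulr1 lerD // ?ge_min ?lexx //.
  by rewrite ler_wpM2r // ge_min lexx orbT.
apply: (@squeeze_cvgr _ _ _ _ (cst 0) (fun t => N / c * t.+1%:R^-1)).
- by apply: nearW => t; exact: bound.
- exact: cvg_cst.
- by rewrite -(mulr0 (N / c)); apply: cvgMr; exact: cvg_harmonic.
Qed.

Lemma payoff_ge0 tau sigma w : 0 <= payoff tau sigma w.
Proof.
have d0 t : 0 <= disc a t by exact/ltW/(hdisc_gt0 t b0).
have f0 x : 0 <= fpay a x by rewrite /= le_max lexx orbT.
rewrite /Defs.payoff; case: (tau w) (sigma w) => [t|] [s|].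
- case: ifP => _; first by rewrite mulr_ge0.
  case: ifP => _; first by rewrite mulr_ge0.
  by rewrite mulr_ge0 //; exact: hpay_ge0.
- by rewrite mulr_ge0.
- by rewrite mulr_ge0.
- by rewrite never_stop_payoff.
Qed.

Lemma measurable_payoff tau sigma : stopping_time X tau -> stopping_time X sigma ->
  measurable_fun setT (payoff tau sigma).
Proof.
move=> ht hs; have mX := measurable_coord hX.
pose H s t w := match s, t with
  | Some s, Some t => if (s < t)%N then disc a s * fpay a (X s w)
      else if (t < s)%N then disc a t * gpay a (X t w) else disc a s * hpay a (X s w)
  | Some s, None => disc a s * fpay a (X s w)
  | None, Some t => disc a t * gpay a (X t w)
  | None, None => limn_sup (fun t => disc a t * hpay a (X t w))
  end.
apply: (measurable_fun_xtime (theta := tau) (H := fun s w => H s (sigma w) w)) => [n|s].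
  exact: stopping_time_measurable.
apply: (measurable_fun_xtime (theta := sigma) (H := H s)) => [n|t].
  exact: stopping_time_measurable.
rewrite /H; case: s t => [s|] [t|].
- case: (s < t)%N; first exact: (measurable_fun_coord hX s (fun x => disc a s * fpay a x)).
  case: (t < s)%N; first exact: (measurable_fun_coord hX t (fun x => disc a t * gpay a x)).
  exact: (measurable_fun_coord hX s (fun x => disc a s * hpay a x)).
- exact: (measurable_fun_coord hX s (fun x => disc a s * fpay a x)).
- exact: (measurable_fun_coord hX t (fun x => disc a t * gpay a x)).
- rewrite [X in measurable_fun _ X](_ : _ = cst 0); first exact: measurable_cst.
  by apply/funext => w; exact: never_stop_payoff.
Qed.

Let start x : states u x -> P x [set w | X 0%N w = x] = 1%E.
Proof. by have [_ _ + _] := hX; apply. Qed.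

Let mstart x : measurable [set w | X 0%N w = x].
Proof. exact: (measurable_coord hX 0 [set x]). Qed.

(** Paths not starting at [x] are null under [P x]. The restricted integral is the one over the root
    of the path tree. *)
Lemma J_start x tau sigma : states u x -> stopping_time X tau ->
  stopping_time X sigma ->
  J x tau sigma =
    (\int[P x]_(w in [set w | X 0%N w = x]) (payoff tau sigma w)%:E)%E.
Proof.
move=> sx ht hs; rewrite /Defs.J unlock.
have mF := measurable_payoff ht hs.
rewrite (@ge0_negligible_integral _ _ _ (P x) _ (~` [set w | X 0%N w = x])) //.
- by rewrite setDE setTI setCK.
- exact: measurableC.
- exact/measurable_EFinP.
- by move=> w _; rewrite lee_fin payoff_ge0.
- transitivity (1 - P x [set w | X 0%N w = x])%E; first exact: probability_setC.
  by rewrite start // subee.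
Qed.

Lemma J_cst x tau sigma c : states u x -> stopping_time X tau ->
  stopping_time X sigma ->
  (forall w, X 0%N w = x -> payoff tau sigma w = c) -> J x tau sigma = c%:E.
Proof.
move=> sx ht hs hc; rewrite J_start // (eq_integral (cst c%:E)).
  rewrite integral_cst //; transitivity (c%:E * 1)%E; last by rewrite mule1.
  by congr (_ * _)%E; exact: start.
by move=> w; rewrite inE /= => /hc ->.
Qed.

Lemma J_le_cst x tau sigma c : states u x -> stopping_time X tau ->
  stopping_time X sigma -> 0 <= c ->
  (forall w, X 0%N w = x -> payoff tau sigma w <= c) -> (J x tau sigma <= c%:E)%E.
Proof.
move=> sx ht hs c0 hc; rewrite J_start //.
have -> : c%:E = (\int[P x]_(w in [set w | X 0%N w = x]) cst c%:E w)%E.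
  rewrite integral_cst //; transitivity (c%:E * 1)%E; first by rewrite mule1.
  by congr (_ * _)%E; rewrite -(start sx).
apply: ge0_le_integral => //.
- by move=> w _; rewrite lee_fin payoff_ge0.
- exact/measurable_EFinP/measurable_funTS/measurable_payoff.
Qed.

(** This is [walk_integral_le] for the log walk with origin [y], with [theta] the smaller of the two
    stopping times, the date at which the payoff is settled. *)
Lemma J_le y k0 tau sigma (G : nat -> nat -> R) : states u y -> (0 < k0)%N ->
  stopping_time X tau -> stopping_time X sigma ->
  (forall t k, 0 <= G t k) ->
  (forall t k, p * G t.+1 k.+2 + (1 - p) * G t.+1 k <= G t k.+1) ->
  (forall w t k, xtime_min (tau w) (sigma w) = Some t -> X t w = y * u ^+ k ->
    payoff tau sigma w <= G t k) ->
  (forall w t, (0 < t)%N -> X t w = y ->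
    xtime_le (tau w) (Some t) || xtime_le (sigma w) (Some t)) ->
  (J (y * u ^+ k0) tau sigma <= (G 0%N k0)%:E)%E.
Proof.
move=> sy k0_gt0 ht hs G0 excG pay stop; have sx := states_mul hu k0 sy.
have hm := stopping_time_min ht hs.
rewrite J_start // -(log_start hu hX k0 sy) -[leRHS]mul1e -(start sx).
rewrite -{1}(log_start hu hX k0 sy).
apply: (walk_integral_le p0 p1 (measurable_log_coord hu hX sy)
  (log_walk_law hu hX k0 sy) k0_gt0 (theta := fun w => xtime_min (tau w) (sigma w))) => //.
- by move=> n; exact: (stopping_time_measurable (measurable_coord hX) n hm).
- exact: (measurable_payoff ht hs).
- by move=> w; exact: payoff_ge0.
- move=> w; rewrite /Defs.payoff.
  by case: (tau w) (sigma w) => [t|] [s|] //= _; exact: never_stop_payoff.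
- move=> w w' t agr; apply: stopping_time_agree hm _.
  move=> k kt; rewrite (coord_log hu hX sy) agr //.
  by rewrite -(coord_log hu hX sy).
- by move=> w t k _ th /(log_coordE hu hX sy) Xt; apply: pay th _.
- move=> w t t0 /(log_coordE hu hX sy); rewrite expr0z mulr1 => Xt.
  by rewrite xtime_min_le stop.
Qed.

Lemma J_ge y k0 tau sigma C : states u y -> 0 <= C ->
  stopping_time X tau -> stopping_time X sigma ->
  (forall w t, X 0%N w = y * u ^+ k0 -> X t w = y ->
    (forall j, (j < t)%N -> y < X j w) -> C * hdisc beta t <= payoff tau sigma w) ->
  ((C * alpha k0)%:E <= J (y * u ^+ k0) tau sigma)%E.
Proof.
move=> sy C0 ht hs pay; have sx := states_mul hu k0 sy.
rewrite J_start // -(log_start hu hX k0 sy) -[leLHS]mul1e -(start sx).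
rewrite -{1}(log_start hu hX k0 sy).
apply: (walk_integral_ge p0 p1 (measurable_log_coord hu hX sy)
  (log_walk_law hu hX k0 sy) b0 C0) => //.
- exact: (measurable_payoff ht hs).
- by move=> w; exact: payoff_ge0.
- move=> w t /(log_coordE hu hX sy) X0 /(log_coordE hu hX sy) Xt pos.
  apply: pay => //; first by rewrite Xt expr0z mulr1.
  move=> j jt; rewrite (coord_log hu hX sy j w) -{1}(mulr1 y) ltr_pM2l ?(states_gt0 hu) //.
  by rewrite -(expr0z u) ltr_eXz2l // pos.
Qed.

Lemma payoff_alone tau w : payoff tau (hit X set0) w =
  if tau w is Some t then hdisc beta t * put (X t w) else 0.
Proof. by rewrite /Defs.payoff hit_set0; case: (tau w) => //; exact: never_stop_payoff. Qed.

Lemma payoff_before_hit (T : set R) tau w : payoff tau (hit X T) w =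
  match tau w, hit X T w with
  | Some t, Some s => if (t < s)%N then hdisc beta t * put (X t w)
                      else if (s < t)%N then hdisc beta s * N
                      else hdisc beta t * h (X t w)
  | Some t, None => hdisc beta t * put (X t w)
  | None, Some s => hdisc beta s * N
  | None, None => 0
  end.
Proof.
rewrite /Defs.payoff; case: (tau w) (hit X T w) => [t|] [s|] //.
exact: never_stop_payoff.
Qed.

Lemma put_ge0 x : 0 <= put x.
Proof. by rewrite le_max lexx orbT. Qed.

Let st0 : stopping_time X (@time0 d Omega) := @stopping_time_cst _ _ _ X (Some 0%N).

Lemma J_stop_in (T : set R) x : states u x -> T x -> J_stop P X a T x = (h x)%:E.
Proof.
move=> sx Tx; apply: J_cst => //; first exact: stopping_time_hit.
move=> w Xw; rewrite payoff_before_hit /time0 hit_start ?Xw //=.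
by rewrite hdisc0 mul1r.
Qed.

Lemma J_stop_notin (T : set R) x : states u x -> ~ T x ->
  J_stop P X a T x = (put x)%:E.
Proof.
move=> sx Tx; apply: J_cst => //; first exact: stopping_time_hit.
move=> w Xw; rewrite payoff_before_hit /time0 Xw hdisc0 mul1r.
case e : hit => [s|//]; rewrite (@hit_start_notin _ _ _ X T w) ?Xw //.
Qed.

Lemma J_opponent_stops (T : set R) x tau : states u x -> T x ->
  stopping_time X tau -> (forall w, xtime_le (Some 1%N) (tau w)) ->
  J x tau (hit X T) = N%:E.
Proof.
move=> sx Tx ht tau1; apply: J_cst => //; first exact: stopping_time_hit.
move=> w Xw; rewrite payoff_before_hit hit_start ?Xw //.
by have := tau1 w; case: (tau w) => [[|t]|] //= _; rewrite hdisc0 mul1r.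
Qed.

Lemma J_alone_le y k0 tau (G : nat -> nat -> R) : states u y -> (0 < k0)%N ->
  stopping_time X tau -> (forall w t, (0 < t)%N -> X t w = y -> xtime_le (tau w) (Some t)) ->
  (forall t k, 0 <= G t k) ->
  (forall t k, p * G t.+1 k.+2 + (1 - p) * G t.+1 k <= G t k.+1) ->
  (forall w t k, tau w = Some t -> X t w = y * u ^+ k ->
    hdisc beta t * put (y * u ^+ k) <= G t k) ->
  (J (y * u ^+ k0) tau (hit X set0) <= (G 0%N k0)%:E)%E.
Proof.
move=> sy k0_gt0 ht stop G0 excG pay; apply: J_le => //.
- exact: stopping_time_hit.
- move=> w t k; rewrite hit_set0 => th Xt; rewrite payoff_alone.
  have {}th : tau w = Some t by case: (tau w) th.
  by rewrite th Xt; exact: (pay w).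
- by move=> w t t0 Xt; rewrite stop.
Qed.

(** The majorant [hitd beta p t k * (K - y)] is harmonic at positive heights and dominates the
    discounted put payoff by [hitd_shift] and [hitd_put]. *)
Lemma J_alone_le_hit y k0 tau : states u y -> (0 < k0)%N -> y <= K ->
  (1 - alpha 1) * K <= (u - alpha 1) * y -> stopping_time X tau ->
  (forall w t, (0 < t)%N -> X t w = y -> xtime_le (tau w) (Some t)) ->
  (J (y * u ^+ k0) tau (hit X set0) <= (alpha k0 * (K - y))%:E)%E.
Proof.
move=> sy k0_gt0 yK hy ht stop.
apply: (J_alone_le (G := fun t k => hitd beta p t k * (K - y))) => //.
- by move=> t k; rewrite mulr_ge0 ?hitd_ge0 // subr_ge0.
- by move=> t k; rewrite !mulrA -mulrDl -hitdS.
- move=> w t k _ _; apply: (@le_trans _ _ (hdisc beta t * alpha k * (K - y))).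
    rewrite -mulrA ler_wpM2l ?(ltW (hdisc_gt0 t b0)) //.
    by apply: hitd_put; rewrite ?(states_gt0 hu sy).
  by rewrite ler_wpM2r ?subr_ge0 // hitd_shift.
Qed.

(** From above, the first visit to [y] is the first entrance into [lower_states u y], and it pays
    [K - y] discounted. *)
Lemma J_alone_ge_hit y k0 : states u y -> (0 < k0)%N -> y <= K ->
  ((alpha k0 * (K - y))%:E <=
   J (y * u ^+ k0) (hit_pos X (lower_states u y)) (hit X set0))%E.
Proof.
move=> sy k0_gt0 yK; have y0 := states_gt0 hu sy.
rewrite mulrC; apply: J_ge => //; first by rewrite subr_ge0.
- exact: stopping_time_hit_pos.
- exact: stopping_time_hit.
- move=> w t X0 Xt above; rewrite payoff_alone.
  have -> : hit_pos X (lower_states u y) w = Some t.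
    apply/xtime_inf_SomeP; split=> [|k kt /= [_ [/andP[_ +] _]]]; last first.
      by rewrite leNgt above.
    split; last by rewrite Xt; split => //=; rewrite y0 lexx.
    rewrite lt0n; apply/eqP => t0; move: Xt; rewrite t0 X0 => /eqP.
    by rewrite -{2}(mulr1 y) (inj_eq (mulfI (lt0r_neq0 y0))) gt_eqF // exprn_egt1 // -lt0n.
  by rewrite Xt mulrC ler_wpM2l ?(ltW (hdisc_gt0 t b0)) // le_max lexx.
Qed.

(* The payoff exceeds the value of waiting until [y] by at most [hdisc t * e k]
   at [y * u ^+ k]. Since the excess [e] has an excessive majorant equal to it at
   1, and stopping at a positive time discounts the excess by [hdisc 1], this
   leaves strictly less than the excess obtained by stopping at once. *)
Lemma J_alone_le_stop y tau : states u y ->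
  (u - alpha 1) * y < (1 - alpha 1) * K -> (u + 1)^-1 <= p ->
  stopping_time X tau -> (forall w, xtime_le (Some 1%N) (tau w)) ->
  (forall w t, (0 < t)%N -> X t w = y -> xtime_le (tau w) (Some t)) ->
  (J (y * u) tau (hit X set0) <=
   (alpha 1 * (K - y) + hdisc beta 1 * (K - y * u - alpha 1 * (K - y)))%:E)%E.
Proof.
move=> sy hy hpu ht tau1 stop; have y0 := states_gt0 hu sy.
have a1 : alpha 1 < 1 := hitd1_lt1 p0 p1 b0.
have yK : y <= K.
  have : (1 - alpha 1) * y <= (u - alpha 1) * y by rewrite ler_pM2r // lerD2r ltW.
  by move=> /le_lt_trans/(_ hy); rewrite ltr_pM2l ?subr_gt0 // => /ltW.
pose e k := K - y * u ^+ k - alpha k * (K - y).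
have [||k|m [m1 m0 em mexc]] := excessive_majorant p0 p1 (e := e).
- by rewrite /e hitd0 // hdisc0; lra.
- by rewrite /e expr1; lra.
- have hs : alpha k.+1 * (K - y) <= (p * alpha k.+2 + (1 - p) * alpha k) * (K - y).
    by rewrite ler_wpM2r ?subr_ge0 // hitd_sub.
  (* The submartingale property, scaled by [u]: [p u^2 - u + (1 - p) = (u - 1) (p (u + 1) - 1) >=
     0]. *)
  have hX1 : y * u ^+ k * u <= y * u ^+ k * (p * u ^+ 2 + (1 - p)).
    rewrite ler_pM2l ?mulr_gt0 ?exprn_gt0 //.
    have : 1 <= p * (u + 1) by rewrite -ler_pdivrMr ?mul1r // addr_gt0.
    have := hu; nra.
  rewrite /e; move: hs hX1; rewrite !exprS expr0 mulr1.
  move: (alpha k.+2) (alpha k.+1) (alpha k) (u ^+ k) => A2 A1 A0 U.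
  lra.
(* The excess part carries the constant [hdisc beta 1] instead of [hdisc beta t]: excessivity of [m]
   is then inherited directly, and domination holds because [tau >= 1]. *)
rewrite -(expr1 u); apply: le_trans (J_alone_le
  (G := fun t k => hitd beta p t k * (K - y) + hdisc beta 1 * m k) _ _ _ _ _ _ _) _ => //.
- move=> t k; rewrite addr_ge0 // mulr_ge0 ?hitd_ge0 ?subr_ge0 //.
  exact/ltW/hdisc_gt0.
- move=> t k; rewrite (hitdS p0 p1 t k b0).
  have := ler_wpM2l (ltW (hdisc_gt0 1 b0)) (mexc k).
  move: (hitd beta p t.+1 k.+2) (hitd beta p t.+1 k) (hdisc beta 1) => A2 A0 D; lra.
- move=> w t k th Xt.
  have t1 : (0 < t)%N by have := tau1 w; rewrite th.
  have d0 := ltW (hdisc_gt0 t b0).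
  apply: (@le_trans _ _ (hdisc beta t * alpha k * (K - y) + hdisc beta t * m k)).
    rewrite -mulrA -mulrDr ler_wpM2l // ge_max; apply/andP; split.
      by have := em k; rewrite /e; lra.
    by rewrite addr_ge0 // mulr_ge0 ?hitd_ge0 // subr_ge0.
  rewrite lerD // ?ler_wpM2r ?subr_ge0 //; first exact: hitd_shift.
  exact: hdisc_le.
- by rewrite m1 /e expr1.
Qed.

(** The majorant is now [hitd beta p t k * N]. The opponent's stop at height 0 yields [N], a
    simultaneous stop at most [N], and an earlier stop is covered by the assumption on the put
    payoff. *)
Lemma J_opponent_le y k0 tau : states u y -> (0 < k0)%N ->
  (forall k, put (y * u ^+ k) <= alpha k * N) -> stopping_time X tau ->
  (J (y * u ^+ k0) tau (hit X (lower_states u y)) <= (alpha k0 * N)%:E)%E.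
Proof.
move=> sy k0_gt0 hput ht; have y0 := states_gt0 hu sy.
have sigmaP w t k : hit X (lower_states u y) w = Some t -> X t w = y * u ^+ k -> k = 0%N.
  move=> /xtime_inf_SomeP[[/= /andP[_ Xy] _] _] Xt; move: Xy; rewrite Xt -{2}(mulr1 y) ler_pM2l //.
  by apply: contraTeq; rewrite -ltNge => k_neq0; rewrite exprn_egt1.
apply: (J_le (G := fun t k => hitd beta p t k * N)) => //.
- exact: stopping_time_hit.
- by move=> t k; rewrite mulr_ge0 ?hitd_ge0.
- by move=> t k; rewrite !mulrA -mulrDl -hitdS.
- move=> w t k th Xt; rewrite payoff_before_hit.
  have fcase : hdisc beta t * put (X t w) <= hitd beta p t k * N.
    rewrite Xt; apply: (@le_trans _ _ (hdisc beta t * alpha k * N)).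
      by rewrite -mulrA ler_wpM2l // ltW // hdisc_gt0.
    by rewrite ler_wpM2r // hitd_shift.
  have gcase : hit X (lower_states u y) w = Some t -> hdisc beta t * N <= hitd beta p t k * N.
    by move=> /sigmaP/(_ Xt) ->; rewrite hitd0.
  have hcase : hdisc beta t * h (X t w) <= hdisc beta t * N.
    by rewrite ler_wpM2l ?(ltW (hdisc_gt0 t b0)) //; have /andP[] := hh (sX t w).
  case: (tau w) th gcase => [t'|]; case: hit => [s|] //=.
  + case: (ltngtP t' s) => [ts|st|<-] [->] gcase //; first exact: gcase.
    exact: le_trans hcase (gcase _).
  + by move=> [->].
  + by move=> [->] /(_ erefl).
- move=> w t t0 Xt; apply/orP; right; apply/xtime_inf_leP; exists t => //=.
  by rewrite Xt; split=> //=; rewrite y0 lexx.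
Qed.

Lemma J_opponent_ge y k0 : states u y -> (0 < k0)%N ->
  ((alpha k0 * N)%:E <=
   J (y * u ^+ k0) (hit_pos X set0) (hit X (lower_states u y)))%E.
Proof.
move=> sy k0_gt0; have y0 := states_gt0 hu sy.
rewrite mulrC; apply: J_ge => //.
- exact: stopping_time_hit_pos.
- exact: stopping_time_hit.
- move=> w t X0 Xt above; rewrite payoff_before_hit hit_pos_set0.
  have -> : hit X (lower_states u y) w = Some t.
    apply/xtime_inf_SomeP; split=> [|k kt /= [/andP[_ +] _]]; last first.
      by rewrite leNgt above.
    by rewrite /= Xt; split => //=; rewrite y0 lexx.
  by rewrite mulrC.
Qed.

End Firm.

(** * The least state above a given level *)

Section Threshold.
Context {R : realType}.
Variable u : R.
Hypothesis hu : 1 < u.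

Let u0 : 0 < u. Proof. exact: lt_trans hu. Qed.

Lemma expr_unbounded (x : R) : exists n, x < u ^+ n.
Proof.
have bernoulli n : 1 + n%:R * (u - 1) <= u ^+ n.
  elim: n => [|n IH]; first by rewrite mul0r addr0 expr0.
  have : 0 <= n%:R * (u - 1) * (u - 1) by rewrite !mulr_ge0 ?subr_ge0 // ltW.
  have := ler_wpM2l (ltW u0) IH; rewrite exprS -natr1.
  by move: (n%:R) => t; lra.
have [n hn] : exists n, `|x| / (u - 1) < n%:R.
  exists (Num.bound (`|x| / (u - 1))); apply: archi_boundP.
  by rewrite divr_ge0 // subr_ge0 ltW.
exists n; apply: lt_le_trans (bernoulli n); rewrite ltr_wpDl //.
by rewrite (le_lt_trans (ler_norm x)) // -ltr_pdivrMr // subr_gt0.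
Qed.

Lemma states_le_or (x y : R) : states u x -> states u y ->
  x <= y \/ exists2 k, (0 < k)%N & x = y * u ^+ k.
Proof.
move=> sx sy; have y0 := states_gt0 hu sy.
have [j ->] := states_ratio hu sx sy.
case: j => [[|k]|k].
- by left; rewrite mulr1.
- by right; exists k.+1.
- left; rewrite -[leRHS]mulr1 ler_pM2l // NegzE -exprnN invf_le1 ?exprn_gt0 //.
  by rewrite exprn_ege1 // ltW.
Qed.

(** Climb from some [u ^- m < c] to the first power reaching [c]; minimality of the exponent gives
    [y / u < c]. *)
Lemma set_min_states (c : R) : 0 < c ->
  let y := set_min [set y | c <= y /\ states u y] in
  [/\ states u y, c <= y & y / u < c].
Proof.
move=> c0; set A := [set y | _].
have [n hn] := expr_unbounded c; have [m hm] := expr_unbounded c^-1.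
have ex : exists k, c <= u ^- m * u ^+ k.
  exists (m + n)%N; rewrite exprD mulKf ?ltW // expf_neq0 // gt_eqF //.
have st k : states u (u ^- m * u ^+ k).
  by apply: (states_mul hu); exists (- m%:Z) => //; rewrite exprnN.
have um0 : 0 < u ^- m by rewrite invr_gt0 exprn_gt0.
case: (ex_minnP ex) => k hk kmin.
have k0 : (0 < k)%N.
  rewrite lt0n; apply/eqP => k0; move: hk; rewrite k0 expr0 mulr1 leNgt.
  by rewrite invf_plt ?posrE ?exprn_gt0 // hm.
have lt_c : u ^- m * u ^+ k / u < c.
  rewrite -(prednK k0) exprSr mulrA mulfK ?gt_eqF // ltNge; apply/negP => /kmin.
  by rewrite leqNgt -(prednK k0) leqnn.
have minA : A (u ^- m * u ^+ k) /\ forall z, A z -> u ^- m * u ^+ k <= z.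
  split=> [//|z [cz sz]]; have [//|[j j0 e]] := states_le_or (st k) sz.
  exfalso; move: lt_c; rewrite ltNge => /negP; apply; apply: le_trans cz _.
  rewrite e -(prednK j0) exprSr mulrA mulfK ?gt_eqF //.
  by rewrite ler_peMr ?exprn_ege1 // ltW // (states_gt0 hu sz).
rewrite /= /set_min (_ : xget 0 _ = u ^- m * u ^+ k) //.
apply: xget_unique => // z [Az zmin]; apply/eqP; rewrite eq_le.
by rewrite zmin ?minA.2 //; case: minA.
Qed.

End Threshold.

(** * The firm facing an opponent who never stops *)

Section Alone.
Context {d : measure_display} {Omega : measurableType d} {R : realType}.
Variables (u p : R) (P : R -> probability Omega R) (X : nat -> Omega -> R).
Hypotheses (hu : 1 < u) (p0 : 0 < p) (p1 : p < 1) (hpu : (u + 1)^-1 <= p).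
Hypothesis hX : markov_chain (states u) (transition u p) P X.
Variables (K N beta : R) (h : R -> R) (y : R).
Hypotheses (K0 : 0 < K) (KN : K <= N) (b0 : 0 < beta).
Hypothesis hh : forall x, states u x -> Num.max (K - x) 0 <= h x <= N.

Local Notation a := (firm K N beta h).
Local Notation put x := (Num.max (K - x) 0).
Local Notation alpha k := (hitd beta p 0 k).
Local Notation T := (lower_states u y).

Hypotheses (sy : states u y) (hy : (1 - alpha 1) * K <= (u - alpha 1) * y)
  (hyu : (u - alpha 1) * (y / u) < (1 - alpha 1) * K).

Let u0 : 0 < u. Proof. exact: lt_trans hu. Qed.
Let y0 : 0 < y. Proof. exact: (states_gt0 hu sy). Qed.
Let a_lt1 : alpha 1 < 1. Proof. exact: hitd1_lt1. Qed.
Let a_gt0 : 0 < alpha 1. Proof. exact: hitd1_gt0. Qed.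

(** With [a = alpha 1], [hyu] gives [(u - a) y < u (1 - a) K], and [u (1 - a) <= u - a] since
    [a (u - 1) >= 0]. *)
Lemma threshold_lt_strike : y < K.
Proof.
have ua : 0 < u - alpha 1 by rewrite subr_gt0 (lt_trans a_lt1).
rewrite -(ltr_pM2l ua); move: hyu; rewrite mulrA ltr_pdivrMr //.
move=> /lt_le_trans; apply; rewrite -mulrA (mulrC K) mulrA ler_pM2r //.
have := a_gt0; have := hu; nra.
Qed.

Let yK := threshold_lt_strike.

Let Tst x : T x -> states u x. Proof. by case. Qed.

Lemma notin_lower_states x : states u x -> ~ T x ->
  exists2 k, (0 < k)%N & x = y * u ^+ k.
Proof.
move=> sx nTx; have [xy|//] := states_le_or hu sx sy.
by case: nTx; split=> //=; rewrite (states_gt0 hu sx).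
Qed.

(** Since [x / u <= y / u], the state [x / u] inherits the strict inequality [hyu] and
    [J_alone_le_stop] applies with base [x / u]. A bound [c] common to all [tau] keeps the
    inequality strict after the supremum in [V]. *)
Lemma stop_in_threshold x : T x -> exists2 c, c < put x &
  forall tau, stopping_time X tau -> (forall w, xtime_le (Some 1%N) (tau w)) ->
  (forall w t, (0 < t)%N -> X t w = x / u -> xtime_le (tau w) (Some t)) ->
  (J P X a x tau (hit X set0) <= c%:E)%E.
Proof.
move=> [/= /andP[x0 xy] sx]; have sxu := states_div hu sx.
have hxu : (u - alpha 1) * (x / u) < (1 - alpha 1) * K.
  apply: le_lt_trans hyu; rewrite ler_pM2l ?subr_gt0 ?(lt_trans a_lt1) //.
  by rewrite ler_pM2r // invr_gt0.
have xE : x = x / u * u by rewrite divfK // gt_eqF.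
exists (alpha 1 * (K - x / u) +
        hdisc beta 1 * (K - x / u * u - alpha 1 * (K - x / u))).
  rewrite lt_max; apply/orP; left.
  have e0 : 0 < K - x / u * u - alpha 1 * (K - x / u) by move: hxu; lra.
  have : hdisc beta 1 * (K - x / u * u - alpha 1 * (K - x / u)) <
      1 * (K - x / u * u - alpha 1 * (K - x / u)) by rewrite ltr_pM2r // hdisc1_lt1.
  by rewrite -xE; lra.
move=> tau ht tau1 stop; rewrite {1}xE.
exact: (J_alone_le_stop hu p0 p1 hX K0 KN b0 hh sxu hxu hpu ht tau1 stop).
Qed.

Let J_stop0 x : states u x -> J_stop P X a set0 x = (put x)%:E.
Proof. by move=> sx; apply: (J_stop_notin hX K0 KN b0 hh sx). Qed.

Lemma wait_outside_threshold k : (0 < k)%N ->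
  (J_stop P X a set0 (y * u ^+ k) <= (alpha k * (K - y))%:E)%E /\
  ((alpha k * (K - y))%:E <= J_cont P X a set0 T (y * u ^+ k))%E.
Proof.
move=> k0; split.
  rewrite J_stop0; last exact: states_mul.
  by rewrite lee_fin; apply: hitd_put => //; exact: ltW.
apply: (J_alone_ge_hit hu p0 p1 hX K0 KN b0 hh sy k0); exact: ltW.
Qed.

(** As [S] lies in [T], [hit_pos X T] comes no later than [hit_pos X S]. Waiting for [T] therefore
    competes in [V], and outside [T] it is at least as good as stopping. *)
Lemma Phi_alone_sub S : S `<=` T -> Phi (states u) P X a set0 S `<=` T.
Proof.
move=> ST x [/ST //|[[sx nSx] VJ]]; apply: contrapT => nTx.
have [k k0 e] := notin_lower_states sx nTx; have [h1 h2] := wait_outside_threshold k0.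
move: VJ; rewrite ltNge => /negP; apply; rewrite e (le_trans h1) // (le_trans h2) //.
apply: ereal_sup_ubound; exists (hit_pos X T); split=> //.
- exact: stopping_time_hit_pos.
- by move=> w; exact: hit_pos_ge1.
- by move=> w; exact: hit_posS.
Qed.

(** A stopping time of at least 1 earns at most [hdisc beta 1 * K], which is less than [K - x] for
    such small [x]. This starts the iteration. *)
Lemma Phi_alone_small x : states u x -> x < (1 - hdisc beta 1) * K ->
  Phi (states u) P X a set0 set0 x.
Proof.
move=> sx hx; right; split; first by split.
  rewrite J_stop0 //.
apply: (@le_lt_trans _ _ (hdisc beta 1 * K)%:E); last first.
  by rewrite lte_fin lt_max; apply/orP; left; move: hx; lra.
apply: ub_ereal_sup => _ [tau [ht tau1 _ ->]].
apply: (J_le_cst hX K0 KN b0 hh sx) => //.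
- exact: stopping_time_hit.
- by rewrite mulr_ge0 ?(ltW K0) // ltW // hdisc_gt0.
- move=> w _; rewrite (payoff_alone hX b0 hh).
  have := tau1 w; case: (tau w) => [t|_]; last first.
    by rewrite mulr_ge0 ?(ltW K0) // ltW // hdisc_gt0.
  move=> /= t1; rewrite ler_pM ?(ltW (hdisc_gt0 _ b0)) ?put_ge0 ?hdisc_le //.
  have [_ sX _ _] := hX.
  by rewrite ge_max (ltW K0) andbT lerBlDl lerDr ltW // (states_gt0 hu).
Qed.

(** A competitor in [V] stops no later than the first positive visit to [S], hence at [x / u] at the
    latest, as [stop_in_threshold] requires. *)
Lemma Phi_alone_next x S : T x -> lower_states u (x / u) `<=` S ->
  Phi (states u) P X a set0 S x.
Proof.
move=> Tx xS; have [Sx|nSx] := pselect (S x); [by left|right].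
split; first by split=> //; exact: Tst.
have [c cx hc] := stop_in_threshold Tx.
rewrite (J_stop0 (Tst Tx)); apply: (@le_lt_trans _ _ c%:E); last by rewrite lte_fin.
apply: ub_ereal_sup => _ [tau [ht tau1 tauS ->]]; apply: hc => // w t t0 Xt.
apply: xtime_le_trans (tauS w) _; apply/xtime_inf_leP; exists t => //.
split=> //; apply: xS; rewrite Xt; have [/andP[x0 _] sx] := Tx.
by split; [rewrite /= lexx divr_gt0|exact: states_div].
Qed.

Lemma iter_Phi_alone_sub n : iter n (Phi (states u) P X a set0) set0 `<=` T.
Proof. by elim: n => [|n IH] //=; exact: Phi_alone_sub. Qed.

(** Each round extends the region reached by [Phi_alone_small] upwards by a factor [u]. *)
Lemma iter_Phi_alone n x : T x -> x < (1 - hdisc beta 1) * K * u ^+ n ->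
  iter n.+1 (Phi (states u) P X a set0) set0 x.
Proof.
elim: n x => [|n IH] x Tx hx.
  by apply: Phi_alone_small; [exact: Tst|move: hx; rewrite mulr1].
rewrite iterS; apply: Phi_alone_next => // z [/= /andP[z0 zx] sz].
have [/andP[x0 xy] _] := Tx.
apply: IH; first split=> //=.
  by rewrite z0 (le_trans zx) // ler_pdivrMr // (le_trans xy) // ler_peMr // ltW.
by apply: le_lt_trans zx _; rewrite ltr_pdivrMr // -[ltRHS]mulrA -exprSr.
Qed.

Lemma Gamma_alone : Gamma (states u) P X a set0 = T.
Proof.
apply/seteqP; split=> x; first by move=> [n _ /iter_Phi_alone_sub].
move=> Tx; have c0 : 0 < (1 - hdisc beta 1) * K.
  by rewrite mulr_gt0 // subr_gt0 hdisc1_lt1.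
have [n hn] := expr_unbounded hu (x / ((1 - hdisc beta 1) * K)).
exists n.+1 => //; apply: iter_Phi_alone => //.
by move: hn; rewrite ltr_pdivrMr // mulrC.
Qed.

(** If the previous iterate lies in [S], then [hit_pos X S] competes in [V]. A new point outside [S]
    would strictly prefer stopping to it, hence belong to [Theta], which is [S]. *)
Lemma iter_Phi_sub_intra_eq S n : intra_eq (states u) P X a set0 S ->
  iter n (Phi (states u) P X a set0) set0 `<=` S.
Proof.
move=> [_ eqS]; elim: n => [//|n IH] x /= [/IH //|[[sx _] VJ]].
apply: contrapT => nSx; apply: (nSx); rewrite -eqS; right; split=> //.
apply: le_lt_trans VJ; apply: ereal_sup_ubound; exists (hit_pos X S); split=> //.
- exact: stopping_time_hit_pos.
- by move=> w; exact: hit_pos_ge1.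
- by move=> w; exact: hit_posS.
Qed.

Lemma J_cont_in_threshold S x : T `<=` S -> T x ->
  (J_cont P X a set0 S x <= J_stop P X a set0 x)%E.
Proof.
move=> TS Tx; have [c cx hc] := stop_in_threshold Tx.
rewrite (J_stop0 (Tst Tx)); apply: (@le_trans _ _ c%:E); last by rewrite lee_fin ltW.
apply: hc => [|w|w t t0 Xt]; [exact: stopping_time_hit_pos|exact: hit_pos_ge1|].
apply/xtime_inf_leP; exists t => //; split=> //; apply: TS; rewrite Xt.
have [/andP[x0 xy] sx] := Tx; split; last exact: states_div.
by rewrite /= divr_gt0 //= ler_pdivrMr // (le_trans xy) // ler_peMr // ltW.
Qed.

(** Every intra-personal equilibrium contains the limit of the iteration, [T]. Outside [T] its
    continuation thus stops at [y] at the latest, and [J_alone_le_hit] caps it by the value that [T]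
    attains; on [T] stopping at once is best for both. *)
Lemma threshold_optimal : optimal_intra_eq (states u) P X a set0 T.
Proof.
split.
  split=> [x /Tst //|]; apply/seteqP; split=> x.
    move=> [[//]|[[sx nTx] /=]]; have [k k0 e] := notin_lower_states sx nTx.
    have [h1 h2] := wait_outside_threshold k0.
    by rewrite e ltNge (le_trans h1).
  by move=> Tx; left; split=> //; exact: J_cont_in_threshold.
move=> S eqS x sx; have TS : T `<=` S.
  by rewrite -Gamma_alone => z [n _]; exact: iter_Phi_sub_intra_eq.
rewrite /U ge_max le_max lexx /= le_max.
have [Tx|nTx] := pselect (T x); first by rewrite J_cont_in_threshold.
have [k k0 e] := notin_lower_states sx nTx; apply/orP; right.
have [_ h2] := wait_outside_threshold k0; rewrite e; apply: le_trans h2.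
apply: (J_alone_le_hit hu p0 p1 hX K0 KN b0 hh sy k0) => //; first exact: ltW.
  exact: stopping_time_hit_pos.
move=> w t t0 Xt; apply/xtime_inf_leP; exists t => //; split=> //; apply: TS.
by rewrite Xt; split => //=; rewrite y0 lexx.
Qed.

End Alone.

(** * The firm facing a threshold opponent *)

Section Waiting.
Context {d : measure_display} {Omega : measurableType d} {R : realType}.
Variables (u p : R) (P : R -> probability Omega R) (X : nat -> Omega -> R).
Hypotheses (hu : 1 < u) (p0 : 0 < p) (p1 : p < 1).
Hypothesis hX : markov_chain (states u) (transition u p) P X.
Variables (K N beta : R) (h : R -> R) (y : R).
Hypotheses (K0 : 0 < K) (KN : K <= N) (b0 : 0 < beta).
Hypothesis hh : forall x, states u x -> Num.max (K - x) 0 <= h x <= N.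

Local Notation a := (firm K N beta h).
Local Notation T := (lower_states u y).

Hypotheses (sy : states u y)
  (hput : forall k, Num.max (K - y * u ^+ k) 0 <= hitd beta p 0 k * N).

Lemma J_cont_opponent_in S x : states u x -> T x -> J_cont P X a T S x = N%:E.
Proof.
move=> sx Tx; apply: (J_opponent_stops hX K0 KN b0 hh sx Tx) => //.
  exact: stopping_time_hit_pos.
by move=> w; exact: hit_pos_ge1.
Qed.

(** Inside [T] the opponent stops at once and waiting yields [N >= h x]; outside, waiting yields at
    least [hitd beta p 0 k * N], which [hput] compares with the put payoff. *)
Lemma stop_le_never x : states u x ->
  (J_stop P X a T x <= J_cont P X a T set0 x)%E.
Proof.
move=> sx; have [Tx|nTx] := pselect (T x).
  rewrite (J_stop_in hX K0 KN b0 hh sx Tx) J_cont_opponent_in // lee_fin.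
  by have /andP[] := hh sx.
rewrite (J_stop_notin hX K0 KN b0 hh sx nTx).
have [k k0 ->] := notin_lower_states hu sy sx nTx.
apply: le_trans (J_opponent_ge hu p0 p1 hX K0 KN b0 hh sy k0).
by rewrite lee_fin.
Qed.

Lemma Gamma_waiting : Gamma (states u) P X a T = set0.
Proof.
have Phi0 : Phi (states u) P X a T set0 = set0.
  apply/seteqP; split=> // x [//|[[sx _]]]; rewrite ltNge => /negP; apply.
  apply: le_trans (stop_le_never sx) _; apply: ereal_sup_ubound.
  exists (hit_pos X set0); split=> //; first exact: stopping_time_hit_pos.
  by move=> w; exact: hit_pos_ge1.
  by move=> w; exact: hit_posS.
have it n : iter n (Phi (states u) P X a T) set0 = set0.
  by elim: n => //= n ->.
by apply/seteqP; split=> // x [n _]; rewrite it.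
Qed.

(** Outside [T] the bounds [J_opponent_le] and [J_opponent_ge] meet; inside [T] every continuation
    yields [N]. *)
Lemma never_stop_optimal : optimal_intra_eq (states u) P X a T set0.
Proof.
split.
  split=> //; apply/seteqP; split=> // x [[//]|[[sx _] /=]].
  by rewrite ltNge stop_le_never.
move=> S _ x sx; rewrite /U ge_max le_max lexx /= le_max; apply/orP; right.
have [Tx|nTx] := pselect (T x); first by rewrite !J_cont_opponent_in.
have [k k0 ->] := notin_lower_states hu sy sx nTx.
apply: le_trans (J_opponent_ge hu p0 p1 hX K0 KN b0 hh sy k0).
apply: (J_opponent_le hu p0 p1 hX K0 KN b0 hh sy k0 hput).
exact: stopping_time_hit_pos.
Qed.

End Waiting.

(** * Assembly of the two best responses into the equilibrium *)

Theorem proposition5p1 (R : realType)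
  (u p r N beta1 beta2 : R) (h1 h2 : R -> R)
  (hu : 1 < u) (hp0 : 0 < p) (hp1 : p < 1) (hpu : (u + 1)^-1 <= p)
  (hr : 0 < r) (hNl : r / 2 < N) (hNr : N < r)
  (hbeta1 : 0 < beta1) (hbeta2 : 0 < beta2)
  (hh1 : forall x, states u x -> Num.max (r - N - x) 0 <= h1 x <= N)
  (hh2 : forall x, states u x -> Num.max (r - N - x) 0 <= h2 x <= N)
  (d : measure_display) (Omega : measurableType d)
  (P : R -> probability Omega R) (X : nat -> Omega -> R)
  (hX : markov_chain (states u) (transition u p) P X)
  (d' : measure_display) (Omega' : measurableType d')
  (Q : probability Omega' R) (Y : nat -> Omega' -> int)
  (hY : random_walk p Q Y) (hY1 : (0 < Q [set w | Y 0%N w = 1%R])%E)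
  (hbeta : beta1 <= beta2) :
  let firm1 := firm (r - N) N beta1 h1 in
  let firm2 := firm (r - N) N beta2 h2 in
  let y2 := threshold u (r - N) (alpha1 beta2 Q Y) in
  let S := alt_S (states u) P X firm1 firm2 in
  let T := alt_T (states u) P X firm1 firm2 in
  let Soo := \bigcup_n S n in
  let Too := \bigcap_n T n in
  [/\ forall n, S n = S 0%N /\ T n = T 0%N,
      (Soo, Too) = (S 0%N, T 0%N),
      (S 0%N, T 0%N) = (set0, [set x | 0 < x <= y2] `&` states u) &
      sharp_inter_eq (states u) P X firm1 firm2 (Soo, Too)].
Proof.
move=> firm1 firm2 y2 S T Soo Too.
have K0 : 0 < r - N by rewrite subr_gt0.
have KN : r - N <= N by move: hNl; lra.
set K := r - N in K0 KN *.
pose al := hitd beta2 p 0 1.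
have al0 : 0 < al := hitd1_gt0 hp0 hp1 hbeta2.
have al1 : al < 1 := hitd1_lt1 hp0 hp1 hbeta2.
have ua : 0 < u - al by rewrite subr_gt0 (lt_trans al1).
have [|sy c_le lt_c] := @set_min_states _ u hu ((1 - al) / (u - al) * K).
  by rewrite mulr_gt0 // divr_gt0 // subr_gt0.
have y2E : y2 = set_min [set y | (1 - al) / (u - al) * K <= y /\ states u y].
  by rewrite /y2 /threshold (alpha1E hp0 hp1 hY).
rewrite -y2E in sy c_le lt_c.
have hy : (1 - al) * K <= (u - al) * y2.
  by rewrite -ler_pdivrMl // mulrA (mulrC (u - al)^-1).
have hyu : (u - al) * (y2 / u) < (1 - al) * K.
  by rewrite -ltr_pdivlMl // [ltRHS]mulrA (mulrC (u - al)^-1).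
have yK := threshold_lt_strike hu hp0 hp1 K0 hbeta2 hyu.
have y0 := states_gt0 hu sy.
(* The bound at the threshold of firm 2 passes to firm 1: a smaller [beta] raises [hitd], and
   [K - y2 <= K <= N]. *)
have hput k : Num.max (K - y2 * u ^+ k) 0 <= hitd beta1 p 0 k * N.
  apply: le_trans (hitd_put hp0 hp1 k hbeta2 hu y0 (ltW yK) hy) _.
  rewrite ler_pM ?hitd_ge0 ?hitd_anti_beta // ?subr_ge0 ?(ltW yK) //.
  by move: KN; lra.
have G2 : Gamma (states u) P X firm2 set0 = lower_states u y2.
  exact: (Gamma_alone hu hp0 hp1 hpu hX K0 KN hbeta2 hh2 sy hy hyu).
have G1 : Gamma (states u) P X firm1 (lower_states u y2) = set0.
  exact: (Gamma_waiting hu hp0 hp1 hX K0 KN hbeta1 hh1 sy hput).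
have S0 n : S n = set0 by elim: n => //= n IH; rewrite /S /= -/(S n) IH G2 G1.
have T0 n : T n = lower_states u y2 by rewrite /T /alt_T -/(S n) S0 G2.
have SooE : Soo = set0 by rewrite /Soo; apply: bigcup0 => n _; rewrite S0.
have TooE : Too = lower_states u y2.
  apply/seteqP; split=> x; first by move=> /(_ 0%N I); rewrite T0.
  by move=> Tx n _; rewrite T0.
split.
- by move=> n; rewrite !S0 !T0.
- by rewrite SooE TooE S0 T0.
- by rewrite S0 T0.
- rewrite SooE TooE; split=> //=.
  + by move=> x [].
  + exact: (never_stop_optimal hu hp0 hp1 hX K0 KN hbeta1 hh1 sy hput).
  + exact: (threshold_optimal hu hp0 hp1 hpu hX K0 KN hbeta2 hh2 sy hy hyu).
Qed.
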